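(* Let $B$ and $C$ be complex vector spaces of the same finite dimension, let $r\ge 1$ be an integer, and let $E\subseteq \mathrm{Hom}(B^*,C)$ be a linear subspace such that the locus $Y=\mathbb{P}E\cap\sigma_r\mathrm{Seg}(\mathbb{P}B\times\mathbb{P}C)$ of matrices of rank at most $r$ in $\mathbb{P}E$ is nonempty. (1) If $v\in\mathrm{Hom}(B^*,C)$ is such that $E'=E+\mathbb{C}v$ is an $r$-lift of $E$, then $v\in \mathrm{RND}_r(E)$. (2) If $E=\mathrm{RND}_r(E)$, then $E$ is $r$-unliftable.
   Context: Everything is over $\mathbb{C}$. Identify $B\otimes C=\mathrm{Hom}(B^*,C)$. $\mathrm{Seg}(\mathbb{P}B\times\mathbb{P}C)\subseteq\mathbb{P}(B\otimes C)$ is the Segre variety, i.e. the variety of classes of rank $1$ matrices, and $\sigma_r\mathrm{Seg}(\mathbb{P}B\times\mathbb{P}C)\subseteq\mathbb{P}(\mathrm{Hom}(B^*,C))$ is its $r$-th secant variety, i.e. the (reduced) projective variety of classes $[e]$ of nonzero matrices $e$ of rank at most $r$ (cut out by the $(r+1)\times(r+1)$ minors). $r$-liftability: a linear subspace $E\subseteq\mathrm{Hom}(B^*,C)$ is $r$-liftable if there is a linear subspace $E'\supsetneq E$ of $\mathrm{Hom}(B^*,C)$ with $$\mathrm{codim}_{\mathbb{P}E}(\mathbb{P}E\cap\sigma_r\mathrm{Seg}(\mathbb{P}B\times\mathbb{P}C))=\mathrm{codim}_{\mathbb{P}E'}(\mathbb{P}E'\cap\sigma_r\mathrm{Seg}(\mathbb{P}B\times\mathbb{P}C)).$$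 Any such $E'$ is called an $r$-lift of $E$. If no such $E'$ exists, $E$ is $r$-unliftable. Rank-$r$-neutral directions: let $Y:=\mathbb{P}E\cap\sigma_r\mathrm{Seg}(\mathbb{P}B\times\mathbb{P}C)$, considered as a scheme-theoretic intersection. Let $Y_1,\dots,Y_k$ be the irreducible components of $Y$ of maximum dimension $\dim Y$. For each $i$ let $\tilde Y_i$ be the set of points $[e]\in Y_i$ which are regular points of the scheme $Y$ and satisfy $\mathrm{rank}(e)=r$. Then $$\mathrm{RND}_r(E):=\bigcup_{1\le i\le k}\ \bigcap_{[e]\in\tilde Y_i}\Bigl(E+\{M\in\mathrm{Hom}(B^*,C)\mid M(\ker e)\subseteq\mathrm{im}\, e\}\Bigr),$$ where the intersection indexed by an empty $\tilde Y_i$ is interpreted as the whole space $\mathrm{Hom}(B^*,C)$. (One has $\mathrm{RND}_r(E)\supseteq E$.) *)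

(* Defs.v *)
From HB Require Import structures.
From mathcomp Require Import all_boot all_order all_algebra.
From mathcomp Require Import boolp classical_sets.
From mathcomp Require Import mpoly.

Set Implicit Arguments.
Unset Strict Implicit.
Unset Printing Implicit Defensive.

Import GRing.Theory.

Local Open Scope classical_set_scope.
Local Open Scope ring_scope.

Definition has_chain (T : Type) (P : set (set T)) (n : nat) : Prop :=
  exists c : nat -> set T,
    (forall i, (i <= n)%N -> P (c i)) /\
    (forall i, (i < n)%N -> c i `<` c i.+1).

(* The supremum of the lengths n of the chains c 0 < ... < c n in P is d; in
   particular P is nonempty.  Every Krull dimension below is of this form. *)
Definition chain_dim (T : Type) (P : set (set T)) (d : nat) : Prop :=
  has_chain P d /\ (forall n, has_chain P n -> (n <= d)%N).

(* Zariski topology on the projective space P(W).  A subset of P(W) is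
   represented by the set of the NONZERO vectors w such that [w] belongs to it.
   Homogeneous polynomials are evaluated in the coordinates with respect to the
   basis vbasis {:W}; the closed sets do not depend on this choice. *)
Section Projective.
Variables (K : fieldType) (W : vectType K).

Definition coords (w : W) : 'I_(\dim {:W}) -> K :=
  fun i => coord (vbasis {:W}) i w.

Definition proj_closed (Z : set W) : Prop :=
  exists S : set {mpoly K[\dim {:W}]},
    (forall f, S f -> exists d : nat, f \is d.-homog) /\
    Z = [set w | w != 0 /\ forall f, S f -> f.@[coords w] = 0].

Definition proj_irreducible (Z : set W) : Prop :=
  [/\ proj_closed Z, Z !=set0 &
      forall Z1 Z2 : set W, proj_closed Z1 -> proj_closed Z2 ->
        Z `<=` Z1 `|` Z2 -> Z `<=` Z1 \/ Z `<=` Z2].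

(* Meant for closed Y: the closed subsets of Y are then the closed subsets of
   P(W) contained in Y.  The empty set has no dimension. *)
Definition proj_dim (Y : set W) (d : nat) : Prop :=
  chain_dim [set Z | proj_irreducible Z /\ Z `<=` Y] d.

Definition proj_component (Y Z : set W) : Prop :=
  [/\ proj_irreducible Z, Z `<=` Y &
      forall Z', proj_irreducible Z' -> Z `<=` Z' -> Z' `<=` Y -> Z' = Z].

Definition top_component (Y : set W) : set (set W) :=
  [set Z | proj_component Y Z /\ exists d, proj_dim Z d /\ proj_dim Y d].

(* codim_{P(E)} Y = c, for Y contained in P(E), which has dimension
   \dim E - 1. *)
Definition proj_codim (E : {vspace W}) (Y : set W) (c : nat) : Prop :=
  exists d, proj_dim Y d /\ (d + c = (\dim E).-1)%N.

End Projective.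

Section LocalRing.
Variables (K : fieldType) (A : comAlgType K).
Implicit Types (J m : set A).

Definition ideal_generated (G : set A) : set A :=
  [set x | exists (n : nat) (a g : 'I_n -> A),
     (forall i, G (g i)) /\ x = \sum_(i < n) a i * g i].

Definition is_prime_ideal (p : set A) : Prop :=
  idealr_closed (mem p) /\ prime_idealr_closed (mem p).

(* For a maximal ideal m of A containing J, the local ring considered in the
   next three definitions is the localization O of A / J at m / J.  Its prime
   ideals are the prime ideals of A lying between J and m. *)
Definition local_krull_dim J m (d : nat) : Prop :=
  chain_dim [set p | [/\ is_prime_ideal p, J `<=` p & p `<=` m]] d.

(* When A / m = K, the cotangent space m_O / m_O^2 of O is m / (m^2 + J).  The
   family x below represents a K-basis of it. *)
Definition cotangent_dim J m (d : nat) : Prop :=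
  let N := ideal_generated (J `|` [set f * g | f in m & g in m]) in
  exists x : 'I_d -> A,
    [/\ forall i, m (x i),
        forall f, m f -> exists c : 'I_d -> K, N (f - \sum_(i < d) c i *: x i) &
        forall c : 'I_d -> K,
          N (\sum_(i < d) c i *: x i) -> forall i, c i = 0].

Definition regular_local J m : Prop :=
  exists d, local_krull_dim J m d /\ cotangent_dim J m d.

End LocalRing.

(* U stands for the dual space B^*. *)
Section Determinantal.
Variables (K : fieldType) (U C : vectType K).
Notation W := 'Hom(U, C).
Implicit Types (E : {vspace W}) (e v : W).

Definition rank e : nat := \dim (limg e).

Definition sigma (r : nat) : set W := [set e | e != 0 /\ (rank e <= r)%N].

Definition proj_space E : set W := [set e | e != 0 /\ e \in E].

Definition rank_locus (r : nat) E : set W := proj_space E `&` sigma r.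

(* If (e, h_1, ..., h_n) is a basis of E, then t |-> [e + \sum_k t_k h_k] is an
   affine chart A^n -> P(E) with origin [e].  In this chart the scheme
   P(E) \cap sigma_r is defined by the (r+1) x (r+1) minors of the generic
   matrix e + \sum_k 'X_k h_k; minors are taken with respect to all families
   psi of vectors of U and phi of linear forms on C, so that no bases of U and C
   have to be chosen. *)
Definition chart_minor (r n : nat) e (h : n.-tuple W)
    (phi : 'I_r.+1 -> 'Hom(C, K^o)) (psi : 'I_r.+1 -> U) : {mpoly K[n]} :=
  \det (\matrix_(i < r.+1, j < r.+1)
    ((phi i (e (psi j)) : K)%:MP
     + \sum_(k < n) (phi i (tnth h k (psi j)) : K) *: 'X_k)).

Definition chart_ideal (r n : nat) e (h : n.-tuple W) : set {mpoly K[n]} :=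
  ideal_generated
    [set f | exists phi psi, f = chart_minor (r := r) e h phi psi].

Definition origin_ideal (n : nat) : set {mpoly K[n]} :=
  [set f | f.@[fun=> 0] = 0].

(* [e] is a regular point of the scheme P(E) \cap sigma_r.  The local ring at
   [e] does not depend on the chart centred at [e]. *)
Definition regular_point (r : nat) E e : Prop :=
  exists h : (\dim E).-1.-tuple W,
    basis_of E (e :: h) /\
    regular_local (chart_ideal r e h) (@origin_ideal (\dim E).-1).

Definition neutral e : set W := [set M | (M @: lker e <= limg e)%VS].

Definition RND (r : nat) E : set W :=
  \bigcup_(Z in top_component (rank_locus r E))
    \bigcap_(e in [set e | [/\ Z e, regular_point r E e & rank e = r]])
      [set u + M | u in [set` E] & M in neutral e].

Definition is_lift (r : nat) E (E' : {vspace W}) : Prop :=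
  [/\ (E <= E')%VS, E != E' &
      exists c, proj_codim E (rank_locus r E) c /\
                proj_codim E' (rank_locus r E') c].

Definition liftable (r : nat) E : Prop := exists E', is_lift r E E'.

Definition unliftable (r : nat) E : Prop := ~ liftable r E.

End Determinantal.

(* Main.v *)
(* Let E' = E + C v be a lift and D = dim Y.  A component Z' of Y' of dimension
   D + 1 meets P(E) in an irreducible Z of dimension D, which is a component of Y.
   Take [e] in Z of rank r, regular on Y, and suppose that v is not in
   E + neutral e.  Then E' and E meet the neutral space of e, i.e. the tangent space
   of the rank locus, in the same subspace, of dimension at most d + 1, where d is
   the local dimension of Y at [e], and d <= D.  But every point of the cone
   over Z', which has dimension D + 2, has a tangent space of dimension at least
   D + 2.
   For (2), every hyperplane section lowers the dimension by at most one, so that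
   E + C v is a lift of E for every v in a lift of E.

   Dimensions are computed by linear sections: a closed subset of P(W) contains a
   chain of length k of irreducible closed subsets if and only if it meets every
   linear subspace of codimension k.  If Z0 < Z are irreducible and Z misses a
   linear subspace L, then the projection from L is finite on Z, so that Z0 does
   not surject onto its target; conversely one cuts by general hyperplanes. *)
Require Import Defs.
From HB Require Import structures.
From mathcomp Require Import all_boot all_order all_algebra perm.
From mathcomp Require Import complex boolp classical_sets reals.
From mathcomp Require Import mpoly ring zify.

Set Implicit Arguments.
Unset Strict Implicit.
Unset Printing Implicit Defensive.

Import Order.TTheory GRing.Theory Num.Theory.

Local Open Scope classical_set_scope.
Local Open Scope ring_scope.

(** * Prime ideals and integrality *)

(** The lower bound for tangent spaces is where characteristic zero enters. Projecting from a linear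
    subspace that Z' misses makes D + 2 coordinates algebraically independent modulo the prime ideal
    P of Z'. The derivations dual to them extend to all variables along the tower of subrings
    K[X_0, ..., X_(j-1)], since every algebraic step is separable. This bounds the rank of Jacobians
    at a generic zero of P, and the rank cannot be larger at a special one. Quotient rings and
    fraction fields never appear: elements are compared modulo P inside one polynomial ring, and
    denominators are cleared by powers of leading coefficients outside P. The same tower yields the
    Nullstellensatz and the basis theorem. Regularity of [e] equates two numbers that are used
    separately: the cotangent dimension controls linear spaces of neutral directions in E, while a
    chain of primes at [e] becomes a chain of closed subsets of Y. *)

Section PrimeIdeal.
Variables (K : fieldType) (S : comAlgType K) (P : set S).
Hypothesis primeP : is_prime_ideal P.

Lemma prime0 : P 0.
Proof. by case: primeP => -[+ _ _] _; rewrite inE. Qed.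

Lemma prime1 : ~ P 1.
Proof. by case: primeP => -[_ + _] _; rewrite notin_setE. Qed.

Lemma primeMD a x y : P x -> P y -> P (a * x + y).
Proof.
move=> Px Py; case: primeP => -[_ _ /(_ a x y)] + _.
by rewrite !inE; apply.
Qed.

Lemma primeMl a x : P x -> P (a * x).
Proof. by move=> Px; rewrite -[_ * _]addr0; apply: primeMD => //; exact: prime0. Qed.

Lemma primeMr a x : P x -> P (x * a).
Proof. by rewrite mulrC; exact: primeMl. Qed.

Lemma primeD x y : P x -> P y -> P (x + y).
Proof. by move=> Px Py; rewrite -[x]mul1r; apply: primeMD. Qed.

Lemma primeN x : P x -> P (- x).
Proof. by rewrite -mulN1r; exact: primeMl. Qed.

Lemma primeB x y : P x -> P y -> P (x - y).
Proof. by move=> Px /primeN; exact: primeD. Qed.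

Lemma prime_sum I (s : seq I) (Q : pred I) (F : I -> S) :
  (forall i, Q i -> P (F i)) -> P (\sum_(i <- s | Q i) F i).
Proof. by move=> PF; elim/big_ind: _ => //; [exact: prime0 | exact: primeD]. Qed.

Lemma primeM x y : P (x * y) -> P x \/ P y.
Proof.
case: primeP => _ /(_ x y); rewrite !inE => H /H /orP[]; rewrite inE; tauto.
Qed.

Lemma primeX x N : P (x ^+ N) -> P x.
Proof.
elim: N => [|N IH]; first by rewrite expr0 => /prime1.
by rewrite exprS => /primeM[].
Qed.

Lemma primeZ c x : P x -> P (c *: x).
Proof. by move=> Px; rewrite -mulr_algl; exact: primeMl. Qed.

End PrimeIdeal.

Section Adjoin.
Variables (S : comNzRingType) (A : subringClosed S) (x : S).

Definition adjoin : {pred S} :=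
  [pred f | `[< exists2 q : {poly S}, q \is a polyOver A & f = q.[x] >]].

Lemma adjoinP f :
  reflect (exists2 q : {poly S}, q \is a polyOver A & f = q.[x]) (f \in adjoin).
Proof. exact: asboolP. Qed.

Lemma adjoin_subring : subring_closed adjoin.
Proof.
split.
- by apply/adjoinP; exists 1; rewrite ?rpred1 ?hornerC.
- move=> _ _ /adjoinP[p Ap ->] /adjoinP[q Aq ->]; apply/adjoinP.
  by exists (p - q); rewrite ?rpredB ?hornerD ?hornerN.
- move=> _ _ /adjoinP[p Ap ->] /adjoinP[q Aq ->]; apply/adjoinP.
  by exists (p * q); rewrite ?rpredM ?hornerM.
Qed.

HB.instance Definition _ := GRing.isSubringClosed.Build S adjoin adjoin_subring.

Lemma adjoin_base f : f \in A -> f \in adjoin.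
Proof. by move=> Af; apply/adjoinP; exists f%:P; rewrite ?polyOverC ?hornerC. Qed.

Lemma adjoin_gen : x \in adjoin.
Proof. by apply/adjoinP; exists 'X; rewrite ?polyOverX ?hornerX. Qed.

Lemma adjoin_sub (B : subringClosed S) :
  {subset A <= B} -> x \in B -> {subset adjoin <= B}.
Proof.
by move=> sAB xB f /adjoinP[q Aq ->]; apply: rpred_horner (polyOverS sAB Aq) xB.
Qed.

End Adjoin.

Section Integral.
Variables (K : fieldType) (S : comAlgType K) (P : set S) (A : subringClosed S).
Hypothesis primeP : is_prime_ideal P.

(* Cayley-Hamilton for multiplication by f on the A-module spanned by the v i. *)
Lemma integral_modulo (s : nat) (v : 'I_s -> S) (f : S) (i0 : 'I_s) :
    v i0 = 1 ->
    (forall i, exists a : 'I_s -> S,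
       (forall j, a j \in A) /\ P (f * v i - \sum_j a j * v j)) ->
  exists q : {poly S}, [/\ q \is monic, q \is a polyOver A & P q.[f]].
Proof.
move=> vi0 /choice[a Ha].
pose M := \matrix_(i, j) a i j.
exists (char_poly M); split; first exact: char_poly_monic.
  apply: rpred_sum => sg _; rewrite rpredM ?rpredX ?rpredN1 //.
  apply: rpred_prod => i _; rewrite !mxE.
  rewrite rpredB ?rpredMn ?polyOverX //.
  by rewrite polyOverC; have [] := Ha i.
have -> : (char_poly M).[f] = \det (f%:M - M).
  rewrite -[LHS]/(horner_eval f (\det _)) -det_map_mx; congr (\det _).
  apply/matrixP=> i j; rewrite !mxE /= /horner_eval hornerD hornerN hornerC.
  by rewrite hornerMn hornerX.
set N := f%:M - M.
have PN i : P (\sum_j N i j * v j).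
  have [_] := Ha i; congr (P _).
  rewrite (bigD1 i) //= [RHS](bigD1 i) //= !mxE eqxx mulr1n mulrBl opprD addrA.
  rewrite -sumrN; congr (_ + _); apply: eq_bigr => j nji.
  by rewrite !mxE eq_sym (negbTE nji) sub0r mulNr.
have -> : \det N = \sum_i (\adj N) i0 i * \sum_j N i j * v j
                 :> S.
  transitivity (\sum_j (\sum_i (\adj N) i0 i * N i j) * v j).
    have E j : \sum_i (\adj N) i0 i * N i j = (\det N) *+ (i0 == j).
      by have /matrixP/(_ i0 j) := mul_adj_mx N; rewrite !mxE.
    rewrite (bigD1 i0) //= E eqxx mulr1n vi0 mulr1 big1 ?addr0 // => j nj.
    by rewrite E eq_sym (negbTE nj) mulr0n mul0r.
  under eq_bigr do rewrite mulr_suml.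
  rewrite exchange_big /=; apply: eq_bigr => i _; rewrite mulr_sumr.
  by apply: eq_bigr => j _; rewrite mulrA.
by apply: (prime_sum primeP) => i _; apply: primeMl.
Qed.

(** Since [f] is outside the prime [P], factors of [f] can be cancelled from the equation until its
    constant term is outside [P]; that term is then a multiple of [f] modulo [P]. *)
Lemma integral_divisor (q : {poly S}) (f : S) :
    q \is monic -> q \is a polyOver A -> P q.[f] -> ~ P f ->
  exists a u : S, [/\ a \in A, u \in adjoin A f, ~ P a & P (a - f * u)].
Proof.
elim/poly_ind: q => [|q c IH] mq Aq Pq nPf.
  by move: mq; rewrite monicE lead_coef0 eq_sym oner_eq0.
have cA : c \in A.
  by move/polyOverP/(_ 0%N): Aq; rewrite coefD coefMX coefC eqxx add0r.
have qA : q \is a polyOver A.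
  by apply/polyOverP=> i; move/polyOverP/(_ i.+1): Aq; rewrite coefD coefMX coefC /= addr0.
case: (pselect (P c)) => [Pc|nPc]; last first.
  exists c, (- q.[f]); split=> //.
    by rewrite rpredN; apply/adjoinP; exists q.
  by move: Pq; rewrite hornerMXaddC mulrN opprK addrC mulrC.
have [q0|q0] := eqVneq q 0.
  move: mq; rewrite q0 mul0r add0r monicE lead_coefC => /eqP c1.
  by case: (prime1 primeP); rewrite -c1.
apply: IH => //.
  move: mq; rewrite !monicE lead_coefDl ?lead_coefMX // size_polyC size_mulX //.
  by apply: leq_ltn_trans (leq_b1 _) _; rewrite ltnS size_poly_gt0.
move: Pq; rewrite hornerMXaddC => Pq.
have : P (q.[f] * f) by rewrite -(addrK c (_ * _)); apply: primeB.
by case/(primeM primeP).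
Qed.

End Integral.

Section MinPoly.
Variables (K : fieldType) (S : comAlgType K) (P : set S) (A : subringClosed S).
Hypothesis primeP : is_prime_ideal P.
Variable x : S.

Definition transcendental_mod : Prop :=
  forall q : {poly S}, q \is a polyOver A -> P q.[x] -> forall i, P q`_i.

(** The minimal polynomial of [x] over the fraction field of [A] modulo [P], with denominators
    cleared: its leading coefficient is only known to lie outside [P]. *)
Definition minpoly_mod (G : {poly S}) (s : nat) : Prop :=
  [/\ G \is a polyOver A, P G.[x], ~ P G`_s, size G = s.+1 &
      forall q : {poly S}, q \is a polyOver A -> (size q <= s)%N ->
        P q.[x] -> forall i, P q`_i].

Lemma transcendental_or_minpoly :
  transcendental_mod \/ exists G s, minpoly_mod G s.
Proof.
case: (pselect transcendental_mod) => [|nT]; [by left | right].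
pose bad n := `[< exists q : {poly S},
  [/\ q \is a polyOver A, size q = n, P q.[x] & ~ forall i, P q`_i] >].
have exbad : exists n, bad n.
  apply/not_existsP => H; apply: nT => q Aq Pq; apply: contrapT => nq.
  by apply: (H (size q)); apply/asboolP; exists q.
case: (ex_minnP exbad) => m /asboolP[G [AG sG PG nG]] minm.
have min q : q \is a polyOver A -> (size q < m)%N -> P q.[x] -> forall i, P q`_i.
  move=> Aq lqm Pq; apply: contrapT => nq.
  by move: lqm; rewrite ltnNge minm //; apply/asboolP; exists q.
case: m => [|s] in sG minm min *.
  case: nG => i; move/eqP: sG; rewrite size_poly_eq0 => /eqP ->.
  by rewrite coef0; exact: prime0 primeP.
exists G, s; split=> // Pc.
have As : G`_s \in A by apply/polyOverP.
(* With the leading coefficient in [P], dropping the leading term leaves a shorter polynomial that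
   still vanishes at [x] modulo [P]. *)
pose q := G - G`_s *: 'X^s.
have Pq i : P q`_i.
  apply: min; first by rewrite rpredB ?polyOverZ ?rpredX ?polyOverX.
    rewrite ltnS; apply/leq_sizeP => j; rewrite leq_eqVlt => /predU1P[<-|ltsj].
      by rewrite coefB coefZ coefXn eqxx mulr1 subrr.
    by rewrite coefB coefZ coefXn gtn_eqF // mulr0 subr0 nth_default ?sG.
  by rewrite hornerD hornerN hornerZ; apply: primeB => //; apply: primeMr.
apply: nG => i; have := Pq i; rewrite coefB => Pqi.
rewrite -(subrK (G`_s *: 'X^s)`_i G`_i); apply: primeD => //.
by rewrite coefZ; apply: primeMr.
Qed.

Variables (G : {poly S}) (s : nat).
Hypothesis minG : minpoly_mod G s.

Lemma minpoly_gt0 : (0 < s)%N.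
Proof.
case: minG => _ PG nPc sG _; case: s sG nPc => // /eqP/size_poly1P[c _ defG].
by move: PG; rewrite defG hornerC coefC.
Qed.

Lemma minpoly_lead : G`_s \in A.
Proof. by case: minG => /polyOverP. Qed.

(** Pseudo-division: [G] is not monic, so each cancellation of a leading term costs a factor of its
    leading coefficient. *)
Lemma minpoly_divide (q : {poly S}) : q \is a polyOver A ->
  exists N (Q R : {poly S}), [/\ Q \is a polyOver A, R \is a polyOver A,
     (size R <= s)%N & G`_s ^+ N *: q = Q * G + R].
Proof.
have [AG _ _ sG _] := minG; set c := G`_s.
have Ac : c \in A := minpoly_lead.
have [n] := ubnP (size q); elim: n => // n IH in q *; rewrite ltnS => lqn Aq.
have [lqs|lsq] := leqP (size q) s.
  by exists 0%N, 0, q; rewrite rpred0 expr0 scale1r mul0r add0r.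
pose d := ((size q).-1 - s)%N; pose l := lead_coef q.
have Al : l \in A by apply/polyOverP.
have lX : l *: 'X^d \is a polyOver A by rewrite polyOverZ ?rpredX ?polyOverX.
pose q1 := c *: q - l *: 'X^d * G.
have Aq1 : q1 \is a polyOver A by rewrite rpredB ?polyOverZ // rpredM.
have sq1 : (size q1 < n)%N.
  apply: leq_trans lqn; rewrite -(ltn_predK lsq) ltnS.
  apply/leq_sizeP => j; rewrite /q1 coefB coefZ -scalerAl coefZ coefXnM.
  have ls1 : (s <= (size q).-1)%N by rewrite -ltnS (ltn_predK lsq).
  rewrite leq_eqVlt => /predU1P[<-|ltj].
    rewrite ltnNge leq_subr /= subKn // -/c mulrC /l lead_coefE mulrC.
    by rewrite mulrC subrr.
  have -> : q`_j = 0 by rewrite nth_default // -(ltn_predK lsq).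
  case: ifP => _; rewrite ?mulr0 ?subr0 //.
  rewrite (nth_default _ (_ : size G <= j - d)%N) ?mulr0 ?subr0 // sG.
  by rewrite ltn_subRL /d addnC subnKC.
have [N [Q [R [AQ AR sR E]]]] := IH _ sq1 Aq1.
exists N.+1, (Q + c ^+ N *: (l *: 'X^d)), R; split=> //.
  by rewrite rpredD // polyOverZ // rpredX.
rewrite exprSr -scalerA -(subrK (l *: 'X^d * G) (c *: q)) -/q1 scalerDr E.
by rewrite mulrDl addrAC -[in RHS]scalerAl.
Qed.

Lemma minpoly_reduce (q : {poly S}) : q \is a polyOver A -> P q.[x] ->
  exists N (Q R : {poly S}), [/\ Q \is a polyOver A, R \is a polyOver A,
     forall i, P R`_i & G`_s ^+ N *: q = Q * G + R].
Proof.
move=> Aq Pq; have [N [Q [R [AQ AR sR E]]]] := minpoly_divide Aq.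
exists N, Q, R; split=> //; case: minG => _ PG _ _; apply=> //.
have -> : R = G`_s ^+ N *: q - Q * G by rewrite E addrC addKr.
by rewrite hornerD hornerN hornerZ hornerM; apply: primeB => //; apply: primeMl.
Qed.

(** A substitute for the norm: modulo [P], the product of [g] and a power of [c] maps the [A]-span
    of the [x ^+ i], [i < s], into itself, hence is integral over [A]. *)
Lemma algebraic_divisor (g : S) : g \in adjoin A x -> ~ P g ->
  exists a u : S, [/\ a \in A, u \in adjoin A x, ~ P a & P (a - g * u)].
Proof.
move=> /adjoinP[q Aq defg] nPg; set c := G`_s.
have Ac : c \in A := minpoly_lead.
have [_ PG nPc _ _] := minG.
have /choice[N /choice[R HR]] : forall i : 'I_s, exists N, exists R : {poly S},
    [/\ R \is a polyOver A, (size R <= s)%N & P (c ^+ N * (g * x ^+ i) - R.[x])].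
  move=> i; have Aqi : q * 'X^i \is a polyOver A.
    by rewrite rpredM ?rpredX ?polyOverX.
  have [N [Q [R [AQ AR sR E]]]] := minpoly_divide Aqi.
  exists N, R; split=> //.
  have -> : c ^+ N * (g * x ^+ i) - R.[x] = Q.[x] * G.[x].
    apply/eqP; rewrite subr_eq; apply/eqP.
    have := congr1 (horner^~ x) E.
    by rewrite hornerZ hornerD !hornerM hornerXn -defg.
  exact: primeMl.
(* One exponent that clears the denominators of all the products [g * x ^+ i] at once. *)
pose M := (\sum_i N i)%N; pose f := c ^+ M * g.
have gB : g \in adjoin A x by apply/adjoinP; exists q.
have cB : c \in adjoin A x by apply: adjoin_base.
have fB : f \in adjoin A x by rewrite rpredM ?rpredX.
have nPf : ~ P f by case/(primeM primeP) => [/(primeX primeP)/nPc|/nPg].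
have [|i|Q [mQ AQ PQ]] := @integral_modulo _ _ _ A primeP s
    (fun i => x ^+ i) f (Ordinal minpoly_gt0); first by rewrite /= expr0.
  exists (fun j : 'I_s => c ^+ (M - N i) * (R i)`_j).
  have [AR sR PR] := HR i; split=> [j|].
    by rewrite rpredM ?rpredX //; apply/polyOverP.
  have -> : f * x ^+ i - \sum_(j < s) c ^+ (M - N i) * (R i)`_j * x ^+ j
     = c ^+ (M - N i) * (c ^+ N i * (g * x ^+ i) - (R i).[x]).
    rewrite mulrBr; congr (_ - _).
      rewrite mulrA -exprD subnK ?mulrA //.
      by rewrite /M (bigD1 i) //= leq_addr.
    rewrite (horner_coef_wide _ sR) mulr_sumr.
    by apply: eq_bigr => j _; rewrite mulrA.
  exact: primeMl.
have [a [u [Aa uf nPa Pau]]] := integral_divisor primeP mQ AQ PQ nPf.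
exists a, (c ^+ M * u); split=> //.
  rewrite rpredM ?rpredX //.
  by apply: adjoin_sub uf => // y; apply: adjoin_base.
by rewrite mulrA (mulrC g).
Qed.

End MinPoly.

(** * Zeros of prime ideals *)

Section Tower.
Variables (K : fieldType) (n : nat).
Implicit Types (f : {mpoly K[n]}) (a : 'I_n -> K).

Definition mconst : {pred {mpoly K[n]}} := [pred f | f == (f@_0%MM)%:MP].

Lemma mconstP f : reflect (exists c, f = c%:MP) (f \in mconst).
Proof.
apply: (iffP eqP) => [->|[c ->]]; first by eexists.
by rewrite mcoeffC eqxx mulr1.
Qed.

Lemma mconst_subring : subring_closed mconst.
Proof.
split; first by apply/mconstP; exists 1.
- move=> _ _ /mconstP[c ->] /mconstP[d ->]; apply/mconstP.
  by exists (c - d); rewrite mpolyCB.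
- move=> _ _ /mconstP[c ->] /mconstP[d ->]; apply/mconstP.
  by exists (c * d); rewrite mpolyCM.
Qed.

HB.instance Definition _ :=
  GRing.isSubringClosed.Build {mpoly K[n]} mconst mconst_subring.

Definition mvar (j : nat) : {mpoly K[n]} := oapp (fun i : 'I_n => 'X_i) 0 (insub j).

Lemma mvarE (i : 'I_n) : mvar i = 'X_i.
Proof. by rewrite /mvar valK. Qed.

(** The polynomials in the first [j] variables, kept as subrings of the full ring so that one prime
    ideal [P] serves at every stage. *)
Fixpoint tower (j : nat) : subringClosed {mpoly K[n]} :=
  if j is j'.+1 then adjoin (tower j') (mvar j') else mconst.

Lemma towerSP j f : reflect
  (exists2 q : {poly {mpoly K[n]}}, q \is a polyOver (tower j) & f = q.[mvar j])
  (f \in tower j.+1).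
Proof. exact: adjoinP. Qed.

Lemma towerS j : {subset tower j <= tower j.+1}.
Proof. by move=> f /= Af; apply: adjoin_base. Qed.

Lemma towerW i j : (i <= j)%N -> {subset tower i <= tower j}.
Proof.
move=> /subnKC<-; elim: (j - i)%N => [|d IH] f; first by rewrite addn0.
by move/IH; rewrite addnS; exact: towerS.
Qed.

Lemma tower_const j c : c%:MP \in tower j.
Proof. by apply: (towerW (leq0n j)); apply/mconstP; exists c. Qed.

Lemma tower_var j (i : 'I_n) : (i < j)%N -> 'X_i \in tower j.
Proof. by move=> ltij; apply: (towerW ltij); rewrite /= -mvarE; apply: adjoin_gen. Qed.

Lemma tower_full f : f \in tower n.
Proof.
rewrite [f]mpolyE rpred_sum // => m _; rewrite -mul_mpolyC.
rewrite rpredM ?tower_const // mpolyXE_id rpred_prod // => i _.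
by rewrite rpredX // tower_var.
Qed.

Lemma meval_horner (q : {poly {mpoly K[n]}}) x a :
  q.[x].@[a] = (map_poly (meval a) q).[x.@[a]].
Proof. by rewrite horner_map. Qed.

Lemma tower_meval j f a a' : f \in tower j ->
  (forall i : 'I_n, (i < j)%N -> a i = a' i) -> f.@[a] = f.@[a'].
Proof.
elim: j => [|j IH] in f * => [/mconstP[c ->] _|]; first by rewrite !mevalC.
move=> /towerSP[q Aq ->] eqa.
have eqx : (mvar j).@[a] = (mvar j).@[a'].
  have [ltjn|lenj] := ltnP j n; last by rewrite /mvar insubF ?mevalC // ltnNge lenj.
  by rewrite -[j]/(val (Ordinal ltjn)) mvarE !mevalXU eqa.
rewrite !meval_horner eqx; congr (_.[_]); apply/polyP => i; rewrite !coef_map /=.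
by apply: IH => [|k ltkj]; [apply/polyOverP | rewrite eqa // ltnW].
Qed.

Lemma mderiv_horner (q : {poly {mpoly K[n]}}) x (i : 'I_n) :
  (q.[x])^`M(i) = (map_poly (mderiv i) q).[x] + q^`().[x] * x^`M(i).
Proof.
elim/poly_ind: q => [|q c IH].
  by rewrite map_poly0 deriv0 !horner0 mderiv0 mul0r addr0.
rewrite hornerMXaddC mderivD mderivM IH derivMXaddC hornerD hornerMX.
rewrite raddfD /= map_polyC /= hornerD hornerC.
have -> : map_poly (mderiv i) (q * 'X) = map_poly (mderiv i) q * 'X.
  apply/polyP => k; rewrite coefMX !coef_map /= coefMX.
  by case: k => //=; rewrite mderiv0.
rewrite hornerMX; ring.
Qed.

Lemma tower_mderiv j f (i : 'I_n) : f \in tower j -> (j <= i)%N -> f^`M(i) = 0.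
Proof.
elim: j => [|j IH] in f * => [/mconstP[c ->] _|]; first by rewrite mderivC.
move=> /towerSP[q Aq ->] ltji; rewrite mderiv_horner.
have -> : map_poly (mderiv i) q = 0.
  apply/polyP => k; rewrite coef_map coef0 /= IH ?(ltnW ltji) //.
  exact/polyOverP.
have ltjn : (j < n)%N by apply: leq_ltn_trans (ltnW ltji) (ltn_ord i).
rewrite -[j in mvar j]/(val (Ordinal ltjn)) mvarE mderivX mnm1E.
by rewrite -val_eqE /= ltn_eqF // scale0r mulr0 horner0 addr0.
Qed.

End Tower.

Section PrimeZeros.
Variables (K : closedFieldType) (n : nat) (P : set {mpoly K[n]}).
Hypothesis primeP : is_prime_ideal P.

(** A zero is extended one coordinate at a time: by any value outside the roots of a nonzero
    polynomial if the new variable is transcendental modulo [P], by a root of its minimal polynomial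
    otherwise. *)
Lemma tower_zero j (g : {mpoly K[n]}) : (j <= n)%N -> g \in tower K n j -> ~ P g ->
  exists a : 'I_n -> K, g.@[a] != 0 /\
    (forall f, f \in tower K n j -> P f -> f.@[a] = 0).
Proof.
elim: j g => [|j IH] g.
  move=> _ /mconstP[c ->] nPc; exists (fun=> 0); rewrite mevalC; split.
    by apply/eqP => c0; apply: nPc; rewrite c0; exact: prime0 primeP.
  move=> _ /mconstP[d ->] Pd; rewrite mevalC; apply/eqP/contraT => d0.
  case: (prime1 primeP); rewrite -(mpolyC1 n K) -(mulVf d0) mpolyCM.
  exact: primeMl.
move=> ltjn /[dup] gB /towerSP[q Aq defg] nPg.
pose i0 := Ordinal ltjn; have xE : mvar K n j = 'X_i0 by rewrite -mvarE.
pose upd (a : 'I_n -> K) b i := if i == i0 then b else a i.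
have evA (f : {mpoly K[n]}) a b : f \in tower K n j -> f.@[upd a b] = f.@[a].
  move=> Af; apply: tower_meval Af _ => i ltij.
  by rewrite /upd -val_eqE /= ltn_eqF.
have evB (p : {poly {mpoly K[n]}}) a b : p \is a polyOver (tower K n j) ->
    p.[mvar K n j].@[upd a b] = (map_poly (meval a) p).[b].
  move=> Ap; rewrite meval_horner xE mevalXU /upd eqxx; congr (_.[_]).
  apply/polyP => i; rewrite !coef_map /=; apply: evA.
  exact/polyOverP.
case: (transcendental_or_minpoly (tower K n j) primeP (mvar K n j)).
  move=> trx; have [k nPk] : exists k, ~ P q`_k.
    apply/existsNP => Pq; apply: nPg; rewrite defg horner_coef.
    by apply: prime_sum => // k _; apply: primeMr.
  have [a [qa0 Pa]] := IH q`_k (ltnW ltjn) (polyOverP Aq k) nPk.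
  have /closed_nonrootP[b qb0] : map_poly (meval a) q != 0.
    by apply: contraNneq qa0 => q0; rewrite -(coef_map (meval a)) q0 coef0.
  exists (upd a b); rewrite defg evB //; split=> // f /towerSP[p Ap ->] Pp.
  rewrite evB // (_ : map_poly _ p = 0) ?horner0 //; apply/polyP => i.
  by rewrite coef_map coef0; apply: Pa; [apply/polyOverP | apply: trx].
move=> [G [s minG]]; have [AG PG nPc sG _] := minG.
(* Nonvanishing of [g] is traded for that of its multiple [h], which lies one stage lower. The
   leading coefficient of [G] is required to be nonzero as well, so that [G] keeps its degree at [a]
   and has a root. *)
have [h [u [Ah uB nPh Phu]]] := algebraic_divisor primeP minG gB nPg.
have [||a [cha Pa]] := IH (G`_s * h) (ltnW ltjn).
- by rewrite rpredM //; apply/polyOverP.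
- by case/(primeM primeP).
move: cha; rewrite mevalM mulf_eq0 negb_or => /andP[ca ha].
have [b Gb] : exists b, root (map_poly (meval a) G) b.
  apply/closed_rootP; rewrite size_map_poly_id0 ?sG.
    by case: s minG {nPc sG ca} => // /minpoly_gt0.
  by rewrite lead_coefE sG.
have Pab f : f \in tower K n j.+1 -> P f -> f.@[upd a b] = 0.
  move=> /towerSP[p Ap ->] Pp.
  have [N [Q [R [AQ AR PR E]]]] := minpoly_reduce primeP minG Ap Pp.
  have := congr1 (fun p => p.[mvar K n j].@[upd a b]) E.
  rewrite hornerZ hornerD hornerM mevalM mevalD mevalM !evB //.
  rewrite (rootP Gb) mulr0 add0r.
  rewrite (_ : map_poly _ R = 0) ?horner0; last first.
    by apply/polyP => i; rewrite coef_map coef0 /= Pa //; apply/polyOverP.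
  move/eqP; rewrite mulf_eq0 => /orP[|/eqP //].
  rewrite evA ?rpredX ?(polyOverP AG) // rmorphXn expf_eq0 (negbTE ca).
  by rewrite andbF.
exists (upd a b); split=> //.
have Bhgu : h - g * u \in tower K n j.+1 by rewrite rpredB ?rpredM // towerS.
have /eqP := Pab _ Bhgu Phu; rewrite mevalB mevalM evA // subr_eq0 => /eqP E.
by apply: contraNneq ha => g0; rewrite E g0 mul0r.
Qed.

(** The Nullstellensatz for prime ideals. *)
Lemma prime_zero (g : {mpoly K[n]}) : ~ P g ->
  exists a : 'I_n -> K, g.@[a] != 0 /\ (forall f, P f -> f.@[a] = 0).
Proof.
move=> /(tower_zero (leqnn n) (tower_full g))[a [ga Pa]].
by exists a; split=> // f; apply: Pa; apply: tower_full.
Qed.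

End PrimeZeros.

(** * Noetherian rings *)

Section Noetherian.

Definition ideal_closed (R : comNzRingType) (I : set R) : Prop :=
  [/\ I 0, forall x y, I x -> I y -> I (x + y) & forall a x, I x -> I (a * x)].

Lemma ideal_closed_sum (R : comNzRingType) (I : set R) (T : Type) (s : seq T)
    (Q : pred T) (F : T -> R) : ideal_closed I ->
  (forall i, Q i -> I (F i)) -> I (\sum_(i <- s | Q i) F i).
Proof. by case=> I0 ID _ IF; elim/big_ind: _. Qed.

Lemma ideal_closedB (R : comNzRingType) (I : set R) x y :
  ideal_closed I -> I x -> I y -> I (x - y).
Proof. by case=> I0 ID IM Ix Iy; apply: ID => //; rewrite -mulN1r; apply: IM. Qed.

Definition in_span (R : comNzRingType) (s : seq R) (x : R) : Prop :=
  exists c : nat -> R, x = \sum_(i < size s) c i * s`_i.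

Definition finitely_generated (R : comNzRingType) : Prop :=
  forall I : set R, ideal_closed I ->
    exists s : seq R, (forall x, x \in s -> I x) /\ (forall x, I x -> in_span s x).

(** The ascending chain condition for the ideals spanned by initial segments of a sequence, the form
    in which the basis theorem and the descent of closed sets consume it. *)
Definition noetherian (R : comNzRingType) : Prop :=
  forall f : nat -> R, exists k, in_span (mkseq f k) (f k).

Variable R : comNzRingType.

Lemma in_span_closed (s : seq R) : ideal_closed (in_span s).
Proof.
split=> [|_ _ [c ->] [d ->]|a _ [c ->]].
- by exists (fun=> 0); rewrite big1 // => i _; rewrite mul0r.
- by exists (fun i => c i + d i); rewrite -big_split; apply: eq_bigr => i _; rewrite mulrDl.
- by exists (fun i => a * c i); rewrite mulr_sumr; apply: eq_bigr => i _; rewrite mulrA.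
Qed.

Lemma in_span_mem (s : seq R) x : x \in s -> in_span s x.
Proof.
move=> sx; have lt := sx; rewrite -index_mem in lt.
exists (fun i => (i == index x s)%:R); rewrite (bigD1 (Ordinal lt)) //= eqxx mul1r.
rewrite nth_index // big1 ?addr0 // => i; rewrite -val_eqE /= => /negbTE->.
by rewrite mul0r.
Qed.

Lemma in_span_sub (I : set R) (s : seq R) x : ideal_closed I ->
  (forall y, y \in s -> I y) -> in_span s x -> I x.
Proof.
move=> idI sI [c ->]; apply: ideal_closed_sum => // i _.
by case: idI => _ _; apply; apply: sI; apply: mem_nth.
Qed.

Lemma in_span_mkseqW (f : nat -> R) i j x : (i <= j)%N ->
  in_span (mkseq f i) x -> in_span (mkseq f j) x.
Proof.
move=> leij; apply: in_span_sub; first exact: in_span_closed.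
move=> y /mapP[k]; rewrite mem_iota => /andP[_ ltk] ->; apply: in_span_mem.
by apply: map_f; rewrite mem_iota /= (leq_trans ltk).
Qed.

Lemma finitely_generated_noetherian : finitely_generated R -> noetherian R.
Proof.
move=> fg f; pose I := [set x | exists k, in_span (mkseq f k) x].
have idI : ideal_closed I.
  split=> [|x y [k kx] [l ly]|a x [k kx]].
  - by exists 0%N; case: (in_span_closed (mkseq f 0)).
  - exists (maxn k l); case: (in_span_closed (mkseq f (maxn k l))) => _ + _; apply.
      by apply: in_span_mkseqW kx; apply: leq_maxl.
    by apply: in_span_mkseqW ly; apply: leq_maxr.
  - by exists k; case: (in_span_closed (mkseq f k)) => _ _; apply.
have [s [sI Is]] := fg I idI.
suff [k sk] : exists k, forall y, y \in s -> in_span (mkseq f k) y.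
  exists k; apply: in_span_sub sk _; first exact: in_span_closed.
  apply: Is; exists k.+1; apply: in_span_mem; apply: map_f.
  by rewrite mem_iota /=.
elim: s sI {Is} => [|x s IH] sI; first by exists 0%N.
have [|k sk] := IH; first by move=> y sy; apply: sI; rewrite inE sy orbT.
have [l lx] := sI x (mem_head _ _); exists (maxn k l) => y.
rewrite inE => /predU1P[->|sy].
  by apply: in_span_mkseqW lx; apply: leq_maxr.
by apply: in_span_mkseqW (sk _ sy); apply: leq_maxl.
Qed.

End Noetherian.

(** Hilbert's basis theorem. Each [g k] has least degree in [I] outside the span of its
    predecessors; once its leading coefficient depends on the earlier ones, subtracting the
    combination [t] of them lowers the degree. *)
Lemma poly_finitely_generated (R : comNzRingType) : noetherian R -> finitely_generated {poly R}.
Proof.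
move=> noethR I idI; apply: contrapT => nfg.
have : forall s : seq {poly R}, exists x, (forall y, y \in s -> I y) ->
    [/\ I x, ~ in_span s x &
        forall y, I y -> ~ in_span s y -> (size x <= size y)%N].
  move=> s; case: (pselect (forall y, y \in s -> I y)) => [sI|]; last by exists 0.
  pose p m := `[< exists x, [/\ I x, ~ in_span s x & size x = m] >].
  have exp : exists m, p m.
    apply/not_existsP => np; apply: nfg; exists s; split=> // x Ix.
    by apply: contrapT => nx; apply: (np (size x)); apply/asboolP; exists x.
  case: (ex_minnP exp) => m /asboolP[x [Ix nx <-]] minx; exists x => _.
  by split=> // y Iy ny; apply: minx; apply/asboolP; exists y.
move=> /choice[next nextP].
pose hist := fix hist k := if k is k'.+1 then rcons (hist k') (next (hist k')) else [::].
pose g k := next (hist k).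
have histE k : hist k = mkseq g k.
  by elim: k => //= k IH; rewrite mkseqS -IH.
have gI k : forall y, y \in mkseq g k -> I y.
  rewrite -histE; elim: k => //= k IH y; rewrite mem_rcons inE => /predU1P[->|].
    by case: (nextP _ IH).
  exact: IH.
have gP k : [/\ I (g k), ~ in_span (mkseq g k) (g k) &
    forall y, I y -> ~ in_span (mkseq g k) y -> (size (g k) <= size y)%N].
  by rewrite -histE; apply: nextP; rewrite histE; apply: gI.
have [k [c Ec]] := noethR (fun k => lead_coef (g k)).
have [Ig ng ming] := gP k.
have g0 i : g i != 0.
  apply/eqP => gi0; have [_ + _] := gP i; apply; rewrite gi0.
  by case: (in_span_closed (mkseq g i)).
have gmono i : (i < k)%N -> (size (g i) <= size (g k))%N.
  move=> ltik; have [_ _] := gP i; apply=> //; apply: contra_not ng.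
  by apply: in_span_mkseqW; apply: ltnW.
rewrite size_mkseq in Ec.
pose t := \sum_(i < k) (c i *: 'X^(size (g k) - size (g i))) * g i.
have tspan : in_span (mkseq g k) t.
  exists (fun i => c i *: 'X^(size (g k) - size (g i))); rewrite size_mkseq.
  by apply: eq_bigr => i _; rewrite nth_mkseq.
have It : I t by apply: in_span_sub tspan => //; apply: gI.
have nt : ~ in_span (mkseq g k) (g k - t).
  move=> h; apply: ng; rewrite -(subrK t (g k)).
  by case: (in_span_closed (mkseq g k)) => _ + _; apply.
have := ming _ (ideal_closedB idI Ig It) nt.
have gk0 : (0 < size (g k))%N by rewrite size_poly_gt0.
rewrite leqNgt -[X in (_ < X)%N](prednK gk0) ltnS => /negP; apply.
apply/leq_sizeP => j; rewrite leq_eqVlt coefB coef_sum => /predU1P[<-|ltj].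
  rewrite -lead_coefE Ec; apply/eqP; rewrite subr_eq0; apply/eqP.
  apply: eq_bigr => i _; rewrite nth_mkseq // -scalerAl coefZ coefXnM lead_coefE.
  have gi0 : (0 < size (g i))%N by rewrite size_poly_gt0.
  have lti := gmono i (ltn_ord i).
  have -> : ((size (g k)).-1 < size (g k) - size (g i))%N = false by lia.
  by congr (_ * _`_ _); lia.
rewrite (nth_default _ (_ : size (g k) <= j)%N); last by rewrite -(prednK gk0).
rewrite big1 ?subr0 // => i _; rewrite -scalerAl coefZ coefXnM.
have lti := gmono i (ltn_ord i).
case: ifP => _; first by rewrite mulr0.
rewrite (nth_default 0 (_ : size (g i) <= _)%N) ?mulr0 //; lia.
Qed.

Lemma surj_finitely_generated (R T : comNzRingType) (phi : {rmorphism T -> R}) :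
  (forall x, exists t, phi t = x) -> finitely_generated T -> finitely_generated R.
Proof.
move=> surj fg I [I0 ID IM].
have [|s [sI Is]] := fg (fun t => I (phi t)).
  by split=> [|x y|a x]; rewrite ?rmorph0 ?rmorphD ?rmorphM; [| apply: ID | apply: IM].
exists (map phi s); split=> [_ /mapP[t st ->]|x Ix]; first exact: sI.
have [t phit] := surj x; rewrite -phit in Ix *.
have [c ->] := Is _ Ix; exists (phi \o c); rewrite size_map rmorph_sum.
by apply: eq_bigr => i _; rewrite (nth_map 0) // rmorphM.
Qed.

Lemma field_finitely_generated (K : fieldType) : finitely_generated K.
Proof.
move=> I [I0 ID IM]; case: (pselect (exists2 x, I x & x != 0)) => [[x Ix x0]|nx].
  exists [:: x]; split=> [y|y _]; first by rewrite inE => /eqP->.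
  by exists (fun=> y / x); rewrite big_ord_recl big_ord0 addr0 /= divfK.
exists [::]; split=> // x Ix; exists (fun=> 0); rewrite big_ord0.
by apply/eqP/contraT => x0; case: nx; exists x.
Qed.

Lemma mpoly_noetherian (K : fieldType) (n : nat) : noetherian {mpoly K[n]}.
Proof.
apply: finitely_generated_noetherian.
(* Finite generation passes along surjections, so it suffices to map an iterated univariate
   polynomial ring [T] onto each stage of the tower. *)
have H j : exists (T : comNzRingType) (phi : {rmorphism T -> {mpoly K[n]}}),
    finitely_generated T /\ (forall f, f \in tower K n j -> exists t, phi t = f).
  elim: j => [|j [T [phi [fgT surj]]]].
    exists K, (@mpolyC n K).
    split; first exact: field_finitely_generated.
    by move=> _ /mconstP[c ->]; exists c.
  have cphi : commr_rmorph phi (mvar K n j) by move=> x; exact: mulrC.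
  exists {poly T}, (horner_morph cphi); split.
    by apply: poly_finitely_generated; apply: finitely_generated_noetherian.
  move=> _ /towerSP[q Aq ->].
  have /choice[t tq] : forall i, exists t, phi t = q`_i.
    by move=> i; apply: surj; apply/polyOverP.
  exists (\poly_(i < size q) t i); rewrite /horner_morph; congr (_.[_]).
  apply/polyP => i; rewrite coef_map coef_poly.
  by case: ltnP => [_|le]; rewrite /= ?tq // nth_default // rmorph0.
have [T [phi [fgT surj]]] := H n.
apply: surj_finitely_generated fgT => f; apply: surj; exact: tower_full.
Qed.

Section PrimeAvoid.
Variables (K : fieldType) (S : comAlgType K) (I : set S) (f : S).
Hypotheses (idI : ideal_closed I) (nf : forall N, ~ I (f ^+ N)).

(** An ideal maximal among those containing [I] and no power of [f] is prime: adjoining any outside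
    element brings in a power of [f], and two such powers multiply. *)
Lemma prime_avoid : exists Q, [/\ is_prime_ideal Q, I `<=` Q & ~ Q f].
Proof.
pose ok J := [/\ ideal_closed J, I `<=` J & forall N, ~ J (f ^+ N)].
have okI : ok I by split.
have [||||[Q okQ] maxQ] := @Zorn {J | ok J} (fun J1 J2 => `[< sval J1 `<=` sval J2 >]).
- by move=> J; apply/asboolP.
- by move=> J1 J2 J3 /asboolP s12 /asboolP s23; apply/asboolP; apply: subset_trans s23.
- move=> [J1 o1] [J2 o2] /= /asboolP s12 /asboolP s21.
  by apply: eq_exist => /=; apply/seteqP.
- move=> C totC; case: (pselect (exists J, C J)) => [[J0 CJ0]|nC]; last first.
    by exists (exist _ I okI) => J CJ; case: nC; exists J.
  pose U := \bigcup_(J in C) sval J.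
  have okU : ok U.
    have up J1 J2 : C J1 -> C J2 ->
        exists J, [/\ C J, sval J1 `<=` sval J & sval J2 `<=` sval J].
      by move=> C1 C2; case: (totC _ _ C1 C2) => /asboolP s; [exists J2; split | exists J1; split].
    split.
    - split.
      + by exists J0 => //; case: (svalP J0) => -[].
      + move=> x y [J1 C1 x1] [J2 C2 y2]; have [J [CJ s1 s2]] := up _ _ C1 C2.
        by exists J => //; case: (svalP J) => -[_ + _] _ _; apply; [apply: s1|apply: s2].
      + by move=> a x [J CJ xJ]; exists J => //; case: (svalP J) => -[_ _ +] _ _; apply.
    - by move=> x Ix; exists J0 => //; case: (svalP J0) => _ + _; apply.
    - by move=> N [J CJ]; case: (svalP J) => _ _ /(_ N).
  by exists (exist _ U okU) => J CJ; apply/asboolP => x Jx; exists J.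
have [idQ sIQ nQ] := okQ; have [Q0 QD QM] := idQ.
exists Q; split=> //; last by move: (nQ 1%N); rewrite expr1.
split.
  split; first by rewrite inE.
    by rewrite notin_setE -(expr0 f).
  by move=> a x y; rewrite !inE => Qx Qy; apply: QD => //; apply: QM.
move=> x y; rewrite inE => Qxy; apply/orP; apply: contrapT => /not_orP[nx ny].
have {}nx : ~ Q x by move=> Qx; apply: nx; rewrite inE.
have {}ny : ~ Q y by move=> Qy; apply: ny; rewrite inE.
have H z : ~ Q z -> exists N u, Q (f ^+ N - u * z).
  move=> nz; apply: contrapT => nN; apply: nz.
  pose J := [set w | exists u, Q (w - u * z)].
  have okJ : ok J.
    split.
    - split.
      + by exists 0; rewrite mul0r subrr.
      + move=> v w [a Qa] [b Qb]; exists (a + b).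
        by rewrite mulrDl opprD addrACA; apply: QD.
      + by move=> a v [b Qb]; exists (a * b); rewrite -mulrA -mulrBr; apply: QM.
    - by move=> w /sIQ Qw; exists 0; rewrite mul0r subr0.
    - by move=> N [u Qu]; apply: nN; exists N, u.
  have := maxQ (exist _ J okJ) => /= /(_ _)/(congr1 sval) /= <-.
    by exists 1; rewrite mul1r subrr.
  by apply/asboolP => w Qw; exists 0; rewrite mul0r subr0.
have [N [u Qu]] := H _ nx; have [M [v Qv]] := H _ ny.
apply: (nQ (N + M)%N); rewrite exprD.
have -> : f ^+ N * f ^+ M = f ^+ M * (f ^+ N - u * x)
    + ((u * x) * (f ^+ M - v * y) + (u * v) * (x * y)) by ring.
by apply: (QD); [apply: QM | apply: (QD); apply: QM].
Qed.

End PrimeAvoid.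

(** * Derivations and tangent vectors *)

Section Derivation.
Variables (K : fieldType) (n : nat).
Implicit Types (f g : {mpoly K[n]}) (c : 'I_n -> {mpoly K[n]}).

Definition derivation c f : {mpoly K[n]} := \sum_i c i * f^`M(i).

Lemma derivation0 c : derivation c 0 = 0.
Proof. by rewrite /derivation big1 // => i _; rewrite mderiv0 mulr0. Qed.

Lemma derivationD c f g : derivation c (f + g) = derivation c f + derivation c g.
Proof.
by rewrite -big_split; apply: eq_bigr => i _; rewrite mderivD mulrDr.
Qed.

Lemma derivationM c f g :
  derivation c (f * g) = derivation c f * g + f * derivation c g.
Proof.
rewrite mulr_suml mulr_sumr -big_split; apply: eq_bigr => i _ /=.
by rewrite mderivM; ring.
Qed.

Lemma derivation_sum c I (s : seq I) (F : I -> {mpoly K[n]}) :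
  derivation c (\sum_(i <- s) F i) = \sum_(i <- s) derivation c (F i).
Proof.
elim: s => [|i s IH]; first by rewrite !big_nil derivation0.
by rewrite !big_cons derivationD IH.
Qed.

End Derivation.

Section Tangent.
Variables (K : numClosedFieldType) (n : nat) (P : set {mpoly K[n]}).
Hypothesis primeP : is_prime_ideal P.

Lemma derivation_stable_horner (A : subringClosed {mpoly K[n]}) c x
    (q : {poly {mpoly K[n]}}) :
  q \is a polyOver A -> (forall i, P q`_i) ->
  (forall f, f \in A -> P f -> P (derivation c f)) -> P (derivation c q.[x]).
Proof.
move=> Aq Pq DA; rewrite horner_coef derivation_sum; apply: prime_sum => // i _.
rewrite derivationM; apply: (primeD primeP).
  by apply: primeMr => //; apply: DA => //; apply/polyOverP.
exact: primeMr.
Qed.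

(* Derivations extend along a separable algebraic step by D' = m D + e d/dx
   with m = G'(x) and e = - D G(x), where G is the minimal polynomial of x. *)
Lemma derivation_extend (l : nat) (i : 'I_n) j : (i < l)%N ->
    (forall f, f \in tower K n l -> P f -> f = 0) -> (l + j <= n)%N ->
  exists c : 'I_n -> {mpoly K[n]},
    [/\ forall f, f \in tower K n (l + j) -> P f -> P (derivation c f),
        ~ P (c i) & forall k : 'I_n, (k < l)%N -> k != i -> c k = 0].
Proof.
move=> ltil indep; elim: j => [|j IH] lejn.
  exists (fun k => (k == i)%:R); split.
  - move=> f; rewrite addn0 => Af /(indep f Af) ->; rewrite derivation0.
    exact: prime0 primeP.
  - by rewrite eqxx; exact: prime1 primeP.
  - by move=> k _ /negbTE->.
rewrite addnS in lejn *; have [c [Dc nPci c0]] := IH (ltnW lejn).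
pose i0 := Ordinal lejn; have xE : mvar K n (l + j) = 'X_i0 by rewrite -mvarE.
set A := tower K n (l + j) in Dc *; set x := mvar K n (l + j) in xE *.
have i0ge (k : 'I_n) : (k < l)%N -> (k == i0) = false.
  by move=> ltkl; rewrite -val_eqE /= ltn_eqF // (leq_trans ltkl) ?leq_addr.
have derA (d : 'I_n -> {mpoly K[n]}) (m e f : {mpoly K[n]}) : (forall k : 'I_n, k != i0 -> d k = m * c k) -> d i0 = e ->
    f \in A -> derivation d f = m * derivation c f.
  move=> dE _ Af; rewrite /derivation mulr_sumr; apply: eq_bigr => k _.
  have [->|/dE->] := eqVneq k i0; last by rewrite mulrA.
  by rewrite (tower_mderiv Af) ?mulr0.
case: (transcendental_or_minpoly A primeP x).
  move=> trx; pose d (k : 'I_n) : {mpoly K[n]} := if k == i0 then 0 else c k.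
  exists d; split; last 2 first.
  - by rewrite /d i0ge.
  - by move=> k ltkl nki; rewrite /d i0ge // c0.
  move=> _ /towerSP[q Aq ->] Pq.
  apply: (derivation_stable_horner _ Aq) => [k|f Af Pf]; first exact: trx.
  rewrite (derA _ 1 0) ?mul1r //; first exact: Dc.
    by move=> k /negbTE nk; rewrite /d nk mul1r.
  by rewrite /d eqxx.
move=> [G [s minG]]; have [AG PG nPc sG minP] := minG.
pose m := G^`().[x].
(* The derivative of [G] is short enough for minimality to apply, so its top coefficient, [s] times
   that of [G], would lie in [P]; [s] is invertible in characteristic zero. *)
have nPm : ~ P m.
  move=> Pm; apply: nPc; have := minpoly_gt0 minG => s0.
  have AG' : G^`() \is a polyOver A.
    by apply/polyOverP => k; rewrite coef_deriv rpredMn //; apply/polyOverP.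
  have sG' : (size G^`() <= s)%N.
    by rewrite (leq_trans (size_poly _ _)) // sG.
  have := minP _ AG' sG' Pm s.-1; rewrite coef_deriv prednK // => Ps.
  have s_neq0 : (s%:R : K) != 0 by rewrite pnatr_eq0 -lt0n.
  rewrite -[G`_s](scalerK s_neq0) scaler_nat; exact: primeZ.
(* With the component along [x] removed, [d0] differentiates only the coefficients of a polynomial
   in [x]. *)
pose d0 (k : 'I_n) : {mpoly K[n]} := if k == i0 then 0 else c k.
pose e := - derivation d0 G.[x].
pose d (k : 'I_n) : {mpoly K[n]} := if k == i0 then e else m * c k.
have dE f : derivation d f = m * derivation d0 f + e * f^`M(i0).
  rewrite /derivation (bigD1 i0) //= [in RHS](bigD1 i0) //= /d /d0 eqxx mul0r add0r.
  rewrite addrC; congr (_ + _); rewrite mulr_sumr; apply: eq_bigr => k /negbTE nk.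
  by rewrite nk mulrA.
have dG : derivation d G.[x] = 0.
  rewrite dE mderiv_horner xE mderivX mnm1E eqxx scale1r.
  rewrite (_ : (U_(i0) - U_(i0))%MM = 0%MM) ?mpolyX0; last first.
    by apply/mnmP => k; rewrite mnmBE mnm0E subnn.
  rewrite (_ : map_poly _ G = 0) ?horner0 ?add0r ?mulr1 -?xE -/m.
    by rewrite /e mulNr mulrC subrr.
  apply/polyP => k; rewrite coef_map coef0 /=.
  by apply: (@tower_mderiv _ _ (l + j)) => //; apply/polyOverP.
exists d; split.
- move=> _ /towerSP[q Aq ->] Pq.
  have [N [Q [R [AQ AR PR E]]]] := minpoly_reduce primeP minG Aq Pq.
  have := congr1 (fun p => derivation d p.[x]) E.
  rewrite /= hornerZ hornerD hornerM derivationM derivationD derivationM dG.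
  rewrite mulr0 addr0 => E'.
  have : P (G`_s ^+ N * derivation d q.[x]).
    rewrite -(addKr (derivation d (G`_s ^+ N) * q.[x]) (_ * derivation _ _)) E'.
    apply: (primeD primeP); first by apply: primeN => //; apply: primeMl.
    apply: (primeD primeP); first exact: primeMl.
    apply: (derivation_stable_horner _ AR) => // f Af Pf.
    rewrite (derA _ m e) //; first by apply: primeMl => //; apply: Dc.
      by move=> k /negbTE nk; rewrite /d nk.
    by rewrite /d eqxx.
  by case/(primeM primeP) => // /(primeX primeP).
- by rewrite /d i0ge // => /(primeM primeP)[].
- by move=> k ltkl nki; rewrite /d i0ge // c0 ?mulr0.
Qed.

Lemma derivation_dual (l : nat) (i : 'I_n) : (i < l <= n)%N ->
    (forall f, f \in tower K n l -> P f -> f = 0) ->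
  exists c : 'I_n -> {mpoly K[n]},
    [/\ forall f, P f -> P (derivation c f),
        ~ P (c i) & forall k : 'I_n, (k < l)%N -> k != i -> c k = 0].
Proof.
move=> /andP[ltil leln] indep.
have [|c [Dc nPc c0]] := @derivation_extend l i (n - l) ltil indep.
  by rewrite subnKC.
exists c; split=> // f Pf; apply: Dc => //; rewrite subnKC //.
exact: tower_full.
Qed.

Definition gradient (f : {mpoly K[n]}) (a : 'I_n -> K) : 'rV[K]_n :=
  \row_k f^`M(k).@[a].

Definition jacobian k (F : 'I_k -> {mpoly K[n]}) (a : 'I_n -> K) : 'M[K]_(k, n) :=
  \matrix_(j, i) (F j)^`M(i).@[a].

(* The rank of the Jacobian at a is attained at a generic zero q of P, where l
   independent derivations preserving P provide l vectors of its kernel. *)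
Lemma jacobian_rank (l k : nat) (F : 'I_k -> {mpoly K[n]}) (a : 'I_n -> K) :
    (l <= n)%N -> (forall f, f \in tower K n l -> P f -> f = 0) ->
    (forall f, P f -> f.@[a] = 0) -> (forall j, P (F j)) ->
  (l + \rank (jacobian F a) <= n)%N.
Proof.
move=> leln indep Pa PF; set J := jacobian F a; set m := \rank J.
have wid (i : 'I_l) : (widen_ord leln i < l <= n)%N by rewrite /= ltn_ord leln.
have /choice[c Hc] := fun i : 'I_l => derivation_dual (wid i) indep.
(* [AL] and [BR] compress the Jacobian at [a] to an identity matrix of size [m], so that one
   polynomial [delta] certifies rank at least [m] wherever it is nonzero. *)
have [AL ALP] : exists AL : 'M[K]_(m, k), AL *m col_base J = 1%:M.
  by exists (pinvmx (col_base J)); rewrite mulVpmx ?col_base_full.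
have [BR BRP] : exists BR : 'M[K]_(n, m), row_base J *m BR = 1%:M.
  by exists (pinvmx (row_base J)); rewrite mulmxVp ?row_base_free.
pose JX : 'M[{mpoly K[n]}]_(k, n) := \matrix_(j, i) (F j)^`M(i).
pose delta := \det (map_mx (@mpolyC n K) AL *m JX *m map_mx (@mpolyC n K) BR).
have deltaE b : delta.@[b] = \det (AL *m jacobian F b *m BR).
  rewrite -det_map_mx 2!map_mxM; congr (\det (_ *m _ *m _)).
  - by apply/matrixP=> i j; rewrite !mxE /= mevalC.
  - by apply/matrixP=> i j; rewrite !mxE.
  - by apply/matrixP=> i j; rewrite !mxE /= mevalC.
have nPdelta : ~ P delta.
  move/Pa/eqP; rewrite deltaE -/J -[X in _ *m X *m _]mulmx_base mulmxA.
  by rewrite ALP mul1mx BRP det1 oner_eq0.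
have nPprod : ~ P (\prod_(i < l) c i (widen_ord leln i)).
  elim/big_ind: _; first exact: prime1 primeP.
    by move=> x y nx ny /(primeM primeP)[].
  by move=> i _; case: (Hc i).
have [|q [dq Pq]] := prime_zero primeP (g := delta * \prod_(i < l) c i (widen_ord leln i)).
  by case/(primeM primeP).
move: dq; rewrite mevalM mulf_eq0 negb_or deltaE rmorph_prod => /andP[dq cq].
have rJ : (m <= \rank (jacobian F q))%N.
  rewrite -(mxrank_unit (A := AL *m jacobian F q *m BR)); last by rewrite unitmxE unitfE.
  by rewrite (leq_trans (mxrankM_maxl _ _)) // mxrankM_maxr.
pose C : 'M[K]_(l, n) := \matrix_(i, j) (c i j).@[q].
(* The first [l] columns of [C] form a diagonal matrix, invertible by the choice of [q]. *)
have rC : row_free C.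
  rewrite -kermx_eq0; apply/rowV0P => v /sub_kermxP vC0; apply/rowP => i.
  move/rowP/(_ (widen_ord leln i)): vC0; rewrite !mxE (bigD1 i) //= big1.
    rewrite addr0 mxE => /eqP; rewrite mulf_eq0 => /orP[/eqP->//|cii].
    by have /prodf_neq0 /(_ i isT) := cq; rewrite /= cii.
  move=> j nji; rewrite mxE; case: (Hc j) => _ _ -> //=; rewrite ?meval0 ?mulr0 //.
  by rewrite -val_eqE /= val_eqE eq_sym.
have CJ : (C <= kermx (jacobian F q)^T)%MS.
  apply/sub_kermxP/matrixP => i j; rewrite !mxE.
  have [/(_ _ (PF j))/Pq] := Hc i; rewrite /derivation raddf_sum /= => E _ _.
  by rewrite -[RHS]E; apply: eq_bigr => k0 _; rewrite !mxE mevalM.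
have := mxrankS CJ; rewrite mxrank_ker mxrank_tr (eqP (_ : \rank C == l)) //.
by have := rank_leq_col (jacobian F q); lia.
Qed.

(** A finite family in [P] whose Jacobian at [a] has maximal rank suffices: the gradient of any
    further element of [P] lies in its row space. *)
Lemma tangent_rank (l : nat) (a : 'I_n -> K) :
    (l <= n)%N -> (forall f, f \in tower K n l -> P f -> f = 0) ->
    (forall f, P f -> f.@[a] = 0) ->
  exists U : 'M[K]_(l, n), row_free U /\
    forall f, P f -> U *m (gradient f a)^T = 0.
Proof.
move=> leln indep Pa.
pose ok m := `[< exists k (F : 'I_k -> {mpoly K[n]}),
   (forall j, P (F j)) /\ \rank (jacobian F a) = m >].
have ok0 : exists m, ok m.
  exists 0%N; apply/asboolP; exists 0%N, (fun=> 0); split; first by case.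
  by apply/eqP; rewrite -leqn0 rank_leq_row.
have okn m : ok m -> (m <= n)%N.
  by move=> /asboolP[k [F [_ <-]]]; apply: rank_leq_col.
case: (ex_maxnP ok0 okn) => m /asboolP[k [F [PF rF]]] maxm.
set N := kermx (jacobian F a)^T.
have lN : (l <= \rank N)%N.
  rewrite mxrank_ker mxrank_tr.
  by have := jacobian_rank leln indep Pa PF; lia.
exists (pid_mx l *m row_base N); split.
  by rewrite /row_free mxrankMfree ?row_base_free // rank_pid_mx.
move=> f Pf; pose F' (j : 'I_(k + 1)) := if split j is inl j' then F j' else f.
have JF' : jacobian F' a = col_mx (jacobian F a) (gradient f a).
  apply/matrixP => j i; rewrite !mxE /F'.
  by case: (split j) => j'; rewrite !mxE.
have : (\rank (jacobian F' a) <= m)%N.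
  apply: maxm; apply/asboolP; exists (k + 1)%N, F'; split=> // j.
  by rewrite /F'; case: (split j).
rewrite JF' -addsmxE -rF => le.
have : (gradient f a <= jacobian F a)%MS.
  have := mxrank_leqif_sup (addsmxSl (jacobian F a) (gradient f a)).
  case=> le2 /esym; rewrite eqn_leq le le2 /= => sub.
  exact: submx_trans (addsmxSr _ _) sub.
case/submxP => D ->; rewrite trmx_mul mulmxA.
have sN : ((pid_mx l : 'M_(l, _)) *m row_base N <= N)%MS by apply: submx_trans (submxMl _ _) _; rewrite eq_row_base.
by rewrite (sub_kermxP sN) mul0mx.
Qed.

End Tangent.

(** * The Zariski topology of a projective space *)

Section Homogeneous.
Variables (K : fieldType) (n : nat).
Implicit Types (f : {mpoly K[n]}).

Lemma dhomog_bigprod I (s : seq I) (e : I -> nat) (F : I -> {mpoly K[n]}) :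
  (forall i, F i \is (e i).-homog) -> \prod_(i <- s) F i \is (\sum_(i <- s) e i).-homog.
Proof.
move=> hF; elim: s => [|i s IH]; first by rewrite !big_nil dhomog1.
by rewrite !big_cons dhomogM.
Qed.

Lemma dhomog_comp k (q : k.-tuple {mpoly K[n]}) (f : {mpoly K[k]}) d :
  (forall i, tnth q i \is 1.-homog) -> f \is d.-homog -> f \mPo q \is d.-homog.
Proof.
move=> hq /dhomogP hf; rewrite comp_mpolyE big_seq rpred_sum // => m /hf /= <-.
rewrite rpredZ // mdegE; apply: dhomog_bigprod => i.
by rewrite -[X in X.-homog]mul1n; apply: dhomogMn.
Qed.

Lemma meval_scale f d (c : K) (a : 'I_n -> K) : f \is d.-homog ->
  f.@[fun i => c * a i] = c ^+ d * f.@[a].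
Proof.
move=> /dhomogP hf; rewrite !mevalE mulr_sumr; apply: eq_big_seq => m /hf /= <-.
rewrite mulrCA mdegE -prodrXr -big_split; congr (_ * _).
by apply: eq_bigr => i _; rewrite exprMn.
Qed.

Lemma pihomogMX d f (i : 'I_n) :
  pihomog mdeg d.+1 (f * 'X_i) = pihomog mdeg d f * 'X_i.
Proof.
rewrite [f in LHS]mpolyE mulr_suml raddf_sum /= pihomogE mulr_suml [RHS]big_mkcond.
apply: eq_bigr => m _; rewrite -!scalerAl linearZ /= -mpolyXD pihomogX /= mdegD mdeg1.
by rewrite addn1 eqSS; case: eqP; rewrite ?scaler0.
Qed.

End Homogeneous.

Section ClosedField.
Variable K : numClosedFieldType.

Lemma poly_neq0_val (p : {poly K}) : (forall c, c != 0 -> p.[c] = 0) -> p = 0.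
Proof.
move=> p0; apply/eqP; apply: contraT => pn0.
have /closed_nonrootP[c] : p * 'X != 0 by rewrite mulf_neq0 ?polyX_eq0.
by rewrite rootE hornerMX mulf_eq0 negb_or => /andP[/eqP pc /p0].
Qed.

(** Restriction to the line through [a] turns homogeneous components into coefficients; hence the
    ideal of a cone contains the components of its elements. *)
Lemma scaled_eval n (f : {mpoly K[n]}) (a : 'I_n -> K) :
  exists p : {poly K}, (forall c, p.[c] = f.@[fun i => c * a i]) /\
    (forall d, p`_d = (pihomog mdeg d f).@[a]).
Proof.
have [N leN] : exists N, (msize f <= N)%N by exists (msize f).
exists (\poly_(d < N) (pihomog mdeg d f).@[a]); split=> [c|d].
  rewrite horner_poly [f in RHS](pihomog_partitionE leN) rmorph_sum /=.
  by apply: eq_bigr => d _; rewrite (meval_scale _ _ (pihomogP _ _ _)) mulrC.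
rewrite coef_poly; case: ltnP => // leNd.
rewrite pihomogE big_seq_cond big_pred0 ?meval0 // => m; apply/negbTE.
rewrite negb_and -implybE; apply/implyP => /msize_mdeg_lt lt.
by rewrite neq_ltn (leq_trans lt) // (leq_trans leN).
Qed.

Lemma mpoly0_prime n : is_prime_ideal [set 0 : {mpoly K[n]}].
Proof.
split; first split; rewrite ?inE //.
- by rewrite notin_setE /=; apply/eqP; rewrite oner_neq0.
- by move=> a x y; rewrite !inE => /= -> ->; rewrite mulr0 addr0.
move=> x y; rewrite !inE /= => /eqP; rewrite mulf_eq0.
by move=> /orP[]/eqP->; rewrite ?eqxx ?orbT; apply/orP; [left|right]; rewrite inE.
Qed.

Lemma meval_eq0 n (f : {mpoly K[n]}) : (forall a, f.@[a] = 0) -> f = 0.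
Proof.
move=> f0; apply: contrapT => nf.
by have [a [/eqP + _]] := prime_zero (@mpoly0_prime n) nf; rewrite f0.
Qed.

End ClosedField.

Section SubspaceForms.
Variables (K : fieldType) (V : vectType K) (L : {vspace V}).

Definition subspace_form (i : 'I_(\dim {:V})) : {linear V -> K^o} :=
  coord (vbasis {:V}) i \o (\1 - projv L)%VF.

Lemma subspace_formP v : v \in L <-> forall i, subspace_form i v = 0.
Proof.
split=> [vL i|H].
  by rewrite /= add_lfunE opp_lfunE id_lfunE projv_id // subrr linear0.
have : (\1 - projv L)%VF v = 0.
  by rewrite [LHS](coord_vbasis (memvf _)) big1 // => i _; rewrite [coord _ _ _]H scale0r.
rewrite add_lfunE opp_lfunE id_lfunE => /eqP; rewrite subr_eq0 => /eqP->.
exact: memv_proj.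
Qed.

End SubspaceForms.

Section ZariskiClosed.
Variables (K : numClosedFieldType) (W : vectType K).
Local Notation n := (\dim {:W}).
Implicit Types (b : n.-tuple W) (w : W) (Z X : set W).

Definition bcoord b w : 'I_n -> K := fun i => coord b i w.

Definition point b (a : 'I_n -> K) : W := \sum_(i < n) a i *: b`_i.

Section Basis.
Variable b : n.-tuple W.
Hypothesis basisb : basis_of {:W} b.

Lemma bcoordK w : point b (bcoord b w) = w.
Proof. by rewrite /point -(coord_basis basisb) ?memvf. Qed.

Lemma pointK a i : bcoord b (point b a) i = a i.
Proof. by rewrite /bcoord /point coord_sum_free // (basis_free basisb). Qed.

Definition lform (phi : W -> K) : {mpoly K[n]} := \sum_(j < n) phi b`_j *: 'X_j.

Lemma lform_homog phi : lform phi \is 1.-homog.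
Proof. by rewrite rpred_sum // => j _; rewrite rpredZ // dhomogX /= mdeg1. Qed.

Lemma lform_eval (phi : {linear W -> K^o}) w : (lform phi).@[bcoord b w] = phi w.
Proof.
rewrite -[w in RHS]bcoordK /lform /point !linear_sum; apply: eq_bigr => j _.
by rewrite /= !linearZ /= mevalXU mulrC.
Qed.

Lemma change_coord k (phi : 'I_k -> {linear W -> K^o}) (f : {mpoly K[k]}) :
  exists g : {mpoly K[n]}, (forall w, g.@[bcoord b w] = f.@[fun i => phi i w]) /\
    (forall d, f \is d.-homog -> g \is d.-homog).
Proof.
exists (f \mPo [tuple lform (phi i) | i < k]); split=> [w|d].
  rewrite comp_mpoly_meval; apply: meval_eq => i.
  by rewrite tnth_mktuple lform_eval.
by apply: dhomog_comp => i; rewrite tnth_mktuple lform_homog.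
Qed.

End Basis.

Lemma zeros_change b b' (S : set {mpoly K[n]}) :
    basis_of {:W} b -> basis_of {:W} b' ->
    (forall f, S f -> exists d, f \is d.-homog) ->
  exists S' : set {mpoly K[n]}, (forall f, S' f -> exists d, f \is d.-homog) /\
    forall w, (forall f, S f -> f.@[bcoord b' w] = 0) <->
              (forall f, S' f -> f.@[bcoord b w] = 0).
Proof.
move=> basisb basisb' hS.
have /choice[F HF] := fun f : {mpoly K[n]} =>
  change_coord basisb (fun i => coord b' i : {linear W -> K^o}) f.
exists (F @` S); split=> [_ [f Sf <-]|w].
  by have [d hd] := hS f Sf; exists d; apply: (HF f).2.
split=> [Z _ [f Sf <-]|Z f Sf]; first by rewrite (HF f).1; exact: Z.
by have := (HF f).1 w; rewrite Z; [move=> <- | exists f].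
Qed.

(** Independence of the basis is needed because each projection is computed in a basis adapted to
    its centre. *)
Lemma proj_closedP b Z : basis_of {:W} b ->
  proj_closed Z <-> exists S : set {mpoly K[n]},
    (forall f, S f -> exists d, f \is d.-homog) /\
    Z = [set w | w != 0 /\ forall f, S f -> f.@[bcoord b w] = 0].
Proof.
move=> basisb; have basisv := vbasisP {:W}.
split=> [[S [hS ->]]|[S [hS ->]]].
  have [S' [hS' SS']] := zeros_change basisb basisv hS; exists S'; split=> //.
  by apply/seteqP; split=> w [w0 /SS' ?].
have [S' [hS' SS']] := zeros_change basisv basisb hS; exists S'; split=> //.
by apply/seteqP; split=> w [w0 /SS' ?].
Qed.

Lemma proj_closed_neq0 Z w : proj_closed Z -> Z w -> w != 0.
Proof. by case=> S [_ ->] []. Qed.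

Lemma proj_closedI X Z : proj_closed X -> proj_closed Z -> proj_closed (X `&` Z).
Proof.
move=> [S [hS ->]] [T [hT ->]]; exists (S `|` T); split=> [f [/hS|/hT]//|].
apply/seteqP; split=> w; first by move=> [[w0 Sw] [_ Tw]]; split=> // f [/Sw|/Tw].
by move=> [w0 STw]; split; split=> // f Sf; apply: STw; [left|right].
Qed.

Lemma proj_closedU X Z : proj_closed X -> proj_closed Z -> proj_closed (X `|` Z).
Proof.
move=> [S [hS ->]] [T [hT ->]].
exists [set f | exists g h, [/\ S g, T h & f = g * h]]; split.
  move=> _ [g [h [/hS[d hd] /hT[e he] ->]]].
  by exists (d + e)%N; apply: dhomogM.
apply/seteqP; split=> w.
  move=> [] [w0 H]; split=> // _ [g [h [Sg Th ->]]]; rewrite mevalM.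
    by rewrite (H g) // mul0r.
  by rewrite (H h) // mulr0.
move=> [w0 H]; case: (pselect (forall f, S f -> f.@[coords w] = 0)) => [Sw|/existsNP[g]].
  by left.
move=> /not_implyP[Sg /eqP ng]; right; split=> // h Th; apply/eqP.
have /eqP := H (g * h) (ex_intro _ g (ex_intro _ h (And3 Sg Th erefl))).
by rewrite mevalM mulf_eq0 (negbTE ng).
Qed.

Lemma proj_closed0 : proj_closed (set0 : set W).
Proof.
exists [set 1]; split=> [_ ->|]; first by exists 0%N; apply: dhomog1.
by apply/seteqP; split=> // w [_ /(_ 1 erefl)/eqP]; rewrite meval1 oner_eq0.
Qed.

Lemma proj_closed_bigcup (F : nat -> set W) m :
  (forall i, (i < m)%N -> proj_closed (F i)) ->
  proj_closed [set w | exists2 i, (i < m)%N & F i w].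
Proof.
elim: m => [|m IH] cF.
  rewrite (_ : [set w | _] = set0); first exact: proj_closed0.
  by apply/seteqP; split=> // w [].
rewrite (_ : [set w | _] = [set w | exists2 i, (i < m)%N & F i w] `|` F m).
  by apply: proj_closedU; [apply: IH => i lti; apply: cF; apply: ltnW | apply: cF].
apply/seteqP; split=> w.
  move=> [k]; rewrite ltnS leq_eqVlt => /predU1P[->|ltk Fk]; first by right.
  by left; exists k.
by move=> [[i lti Fi]|Fm]; [exists i; rewrite // ltnW | exists m].
Qed.

Lemma proj_closed_forms (k : nat) (phi : 'I_k -> {linear W -> K^o}) :
  proj_closed [set w | w != 0 /\ forall i, phi i w = 0].
Proof.
apply/(proj_closedP _ (vbasisP {:W})).
exists [set lform (vbasis {:W}) (phi i) | i in [set: 'I_k]]; split.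
  by move=> _ [i _ <-]; exists 1%N; apply: lform_homog.
apply/seteqP; split=> w [w0 H]; split=> //.
  by move=> _ [i _ <-]; rewrite lform_eval ?vbasisP.
by move=> i; rewrite -(lform_eval (vbasisP {:W})); apply: H; exists i.
Qed.

Lemma proj_closed_space (L : {vspace W}) : proj_closed [set w | w != 0 /\ w \in L].
Proof.
rewrite (_ : [set w | _] = [set w | w != 0 /\ forall i, subspace_form L i w = 0]).
  exact: proj_closed_forms.
by apply/seteqP; split=> w [w0 /subspace_formP].
Qed.

Lemma proj_closed_scale Z w c : proj_closed Z -> Z w -> c != 0 -> Z (c *: w).
Proof.
move=> [S [hS ->]] [w0 Sw] c0; split=> [|f Sf]; first by rewrite scaler_eq0 negb_or c0.
have [d hd] := hS f Sf.
transitivity (f.@[fun i => c * coords w i]); last by rewrite (meval_scale _ _ hd) Sw ?mulr0.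
by apply: meval_eq => i; rewrite /coords linearZ.
Qed.

Definition vanishing b Z : set {mpoly K[n]} :=
  [set f | forall w, Z w -> f.@[bcoord b w] = 0].

Section Vanishing.
Variable b : n.-tuple W.
Hypothesis basisb : basis_of {:W} b.

Lemma scaled_bcoord w : forall f : {mpoly K[n]}, exists p : {poly K},
    (forall c, p.[c] = f.@[bcoord b (c *: w)]) /\
    (forall d, p`_d = (pihomog mdeg d f).@[bcoord b w]).
Proof.
move=> f; have [p [pE pd]] := scaled_eval f (bcoord b w); exists p; split=> // c.
by rewrite pE; apply: meval_eq => i; rewrite /bcoord linearZ.
Qed.

Lemma vanishing_pihomog Z f d : proj_closed Z -> vanishing b Z f ->
  vanishing b Z (pihomog mdeg d f).
Proof.
move=> cZ Zf w Zw; have [p [pE <-]] := scaled_bcoord w f.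
rewrite (_ : p = 0) ?coef0 //; apply: poly_neq0_val => c c0.
by rewrite pE Zf //; apply: proj_closed_scale.
Qed.

Lemma vanishing_zero Z w : proj_closed Z -> w != 0 ->
  (forall f, vanishing b Z f -> f.@[bcoord b w] = 0) -> Z w.
Proof.
move=> /(proj_closedP _ basisb)[S [_ ->]] w0 H; split=> // f Sf.
by apply: H => u [_]; apply.
Qed.

Lemma vanishing_prime Z : proj_irreducible Z -> is_prime_ideal (vanishing b Z).
Proof.
move=> [cZ [w0 Zw0] irr]; split; first split.
- by rewrite inE => w _; rewrite meval0.
- by rewrite notin_setE => /(_ w0 Zw0)/eqP; rewrite meval1 oner_eq0.
- move=> a f g; rewrite !inE => Zf Zg w Zw.
  by rewrite mevalD mevalM Zf // Zg // mulr0 addr0.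
(* Closed sets have homogeneous equations, so all components of [f] are made to vanish. On the line
   through a point of [Z] the restrictions of [f] and [g] have product zero, hence one of them is
   zero. *)
pose V (f : {mpoly K[n]}) :=
  [set w | w != 0 /\ forall d, (pihomog mdeg d f).@[bcoord b w] = 0].
have cV f : proj_closed (V f).
  apply/(proj_closedP _ basisb); exists [set pihomog mdeg d f | d in [set: nat]].
  split; first by move=> _ [d _ <-]; exists d; apply: pihomogP.
  apply/seteqP; split=> w [nw H]; split=> //; first by move=> _ [d _ <-].
  by move=> d; apply: H; exists d.
have ZV f : Z `<=` V f -> vanishing b Z f.
  move=> sub w /sub[_ fw]; have [p [pE pd]] := scaled_bcoord w f.
  have := pE 1; rewrite scale1r => <-; rewrite (_ : p = 0) ?horner0 //.
  by apply/polyP => d; rewrite pd fw coef0.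
move=> f g; rewrite inE => Zfg; apply/orP.
have [|sub|sub] := irr (V f) (V g) (cV f) (cV g).
- move=> w Zw; have nw := proj_closed_neq0 cZ Zw.
  have [p [pE pd]] := scaled_bcoord w f; have [q [qE qd]] := scaled_bcoord w g.
  have /eqP : p * q = 0.
    apply: poly_neq0_val => c c0; rewrite hornerM pE qE -mevalM Zfg //.
    exact: proj_closed_scale.
  rewrite mulf_eq0 => /orP[]/eqP z; [left|right]; split=> // d.
    by rewrite -pd z coef0.
  by rewrite -qd z coef0.
- by left; rewrite inE; apply: ZV.
- by right; rewrite inE; apply: ZV.
Qed.

End Vanishing.

End ZariskiClosed.

Section FiniteIndex.
Variables (K : fieldType) (S : comAlgType K) (P : set S) (A : subringClosed S).
Hypothesis primeP : is_prime_ideal P.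

Lemma integral_modulo_fin (T : finType) (v : T -> S) (f : S) (t0 : T) :
    v t0 = 1 ->
    (forall t, exists a : T -> S,
       (forall u, a u \in A) /\ P (f * v t - \sum_u a u * v u)) ->
  exists q : {poly S}, [/\ q \is monic, q \is a polyOver A & P q.[f]].
Proof.
move=> v1 H; apply: (@integral_modulo _ _ _ A primeP #|T| (v \o enum_val) f (enum_rank t0)).
  by rewrite /= enum_rankK.
move=> i; have [a [Aa Pa]] := H (enum_val i); exists (a \o enum_val); split=> [j|] /=.
  exact: Aa.
by rewrite -(big_enum_val (A := T) (fun u => a u * v u)).
Qed.

End FiniteIndex.

(** * Irreducible decomposition, and linear subspaces missing a closed set *)

Section Irreducible.
Variables (K : numClosedFieldType) (W : vectType K).
Local Notation n := (\dim {:W}).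
Implicit Types (w : W) (Z X : set W) (L : {vspace W}).

Lemma irreducible_bigcup Z (F : nat -> set W) m : proj_irreducible Z ->
    (forall i, (i < m)%N -> proj_closed (F i)) ->
    (forall w, Z w -> exists2 i, (i < m)%N & F i w) ->
  exists2 i, (i < m)%N & Z `<=` F i.
Proof.
move=> irrZ; elim: m => [|m IH] cF ZF.
  by case: irrZ => _ [w /ZF[]].
have cF' : forall i, (i < m)%N -> proj_closed (F i).
  by move=> i lti; apply: cF; apply: ltnW.
case: irrZ => _ _ /(_ _ _ (proj_closed_bigcup cF') (cF m (ltnSn m))).
case=> [w /ZF[k]|sub|sub]; last by exists m.
  rewrite ltnS leq_eqVlt => /predU1P[->|ltk Fk]; first by right.
  by left; exists k.
by have [k ltk sk] := IH cF' sub; exists k; rewrite // ltnW.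
Qed.

(** Pick [f k] vanishing on [X k.+1] but not on [X k]. Some [f k] is a combination of earlier ones,
    all of which vanish on [X k]. *)
Lemma proj_closed_dcc (X : nat -> set W) :
  (forall k, proj_closed (X k)) -> ~ (forall k, X k.+1 `<` X k).
Proof.
move=> cX dX; set b := vbasis {:W}.
have /choice[f Hf] k : exists f : {mpoly K[n]},
    vanishing b (X k.+1) f /\ ~ vanishing b (X k) f.
  have [S [hS XE]] := cX k.+1; have [sub nsub] := dX k.
  apply: contrapT => nf; apply: nsub => w Xw; rewrite XE.
  split; first by case: (cX k) Xw => T [_ ->] [].
  move=> f Sf; apply: contrapT => nfw; apply: nf; exists f; split.
    by move=> u; rewrite XE => -[_]; apply.
  by move=> /(_ w Xw).
have [k [c Ec]] := mpoly_noetherian f; have [_] := Hf k; apply=> w Xw.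
have mono j : (j <= k)%N -> X k `<=` X j.
  move=> /subnKC <-; elim: (k - j)%N => [|d IH]; first by rewrite addn0.
  by rewrite addnS; apply: subset_trans IH; case: (dX (j + d)%N).
rewrite Ec size_mkseq rmorph_sum big1 //= => i _; rewrite nth_mkseq // mevalM.
by have [-> //] := Hf i; rewrite ?mulr0 //; apply: mono Xw.
Qed.

Definition decomposable X : Prop := exists m (F : nat -> set W),
  (forall i, (i < m)%N -> proj_irreducible (F i) /\ F i `<=` X) /\
  (forall w, X w -> exists2 i, (i < m)%N & F i w).

Lemma decomposableU X X1 X2 : X1 `<=` X -> X2 `<=` X -> X `<=` X1 `|` X2 ->
  decomposable X1 -> decomposable X2 -> decomposable X.
Proof.
move=> s1 s2 s12 [m1 [F1 [H1 C1]]] [m2 [F2 [H2 C2]]].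
exists (m1 + m2)%N, (fun i => if (i < m1)%N then F1 i else F2 (i - m1)%N); split.
  move=> i lti; case: ltnP => [/H1[? s]|le]; first by split=> //; apply: subset_trans s1.
  have [|? s] := H2 (i - m1)%N; first by lia.
  by split=> //; apply: subset_trans s2.
move=> w /s12[/C1[k ltk Fk]|/C2[k ltk Fk]].
  by exists k; [lia | rewrite ltk].
by exists (m1 + k)%N; [lia | rewrite ltnNge leq_addr /= addKn].
Qed.

(** Noetherian induction: a closed set without decomposition splits into two proper closed pieces,
    one of which again has none, and iterating descends forever. *)
Lemma closed_decomposable X : proj_closed X -> decomposable X.
Proof.
move=> cX; apply: contrapT => nX.
pose bad Y := proj_closed Y /\ ~ decomposable Y.
have step Y : exists Y', bad Y -> bad Y' /\ Y' `<` Y.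
  case: (pselect (bad Y)) => [[cY nY]|]; last by exists Y.
  case: (pselect (proj_irreducible Y)) => [iY|niY].
    by case: nY; exists 1%N, (fun=> Y); split=> [k _|w Yw]; [split | exists 0%N].
  case: (pselect (Y !=set0)) => [Y0|Y0]; last first.
    case: nY; exists 0%N, (fun=> set0); split=> // w Yw.
    by case: Y0; exists w.
  have [Z1 [Z2 [c1 [c2 [s12 n12]]]]] : exists Z1 Z2, proj_closed Z1 /\ proj_closed Z2 /\
      Y `<=` Z1 `|` Z2 /\ ~ (Y `<=` Z1 \/ Y `<=` Z2).
    apply: contrapT => nZ; apply: niY; split=> // Z1 Z2 c1 c2 s12.
    by apply: contrapT => n12; apply: nZ; exists Z1, Z2.
  have [n1 n2] : ~ Y `<=` Z1 /\ ~ Y `<=` Z2.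
    by split=> h; apply: n12; [left|right].
  have sub Z : proj_closed Z -> ~ Y `<=` Z -> ~ decomposable (Y `&` Z) ->
      bad (Y `&` Z) /\ Y `&` Z `<` Y.
    move=> cZ nZ nd; split; first by split=> //; apply: proj_closedI.
    by split=> [w []//|s]; apply: nZ => w /s[].
  case: (pselect (decomposable (Y `&` Z1))) => [d1|nd1]; last first.
    by exists (Y `&` Z1) => _; apply: sub.
  case: (pselect (decomposable (Y `&` Z2))) => [d2|nd2]; last first.
    by exists (Y `&` Z2) => _; apply: sub.
  case: nY; apply: decomposableU d1 d2; try by move=> w [].
  by move=> w Yw; case: (s12 w Yw) => h; [left|right]; split.
have /choice[next nextP] := step.
pose seqX k := iter k next X.
have badX k : bad (seqX k) by elim: k => [//|k /nextP[]].
by apply: (proj_closed_dcc (X := seqX)) => k; [case: (badX k) | case: (nextP _ (badX k))].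
Qed.

(** The forms with coefficients [t ^+ j] run along a moment curve: each nonzero vector excludes only
    the roots of one nonzero polynomial in [t]. *)
Lemma avoid_form (w : nat -> W) m : (forall i, (i < m)%N -> w i != 0) ->
  exists phi : 'Hom(W, K^o), forall i, (i < m)%N -> phi (w i) != 0.
Proof.
move=> w0; set b := vbasis {:W}.
pose p u := \sum_(j < n) coord b j u *: ('X^j : {poly K}).
have p0 u : u != 0 -> p u != 0.
  apply: contraNneq => pu0; rewrite (coord_vbasis (memvf u)) big1 // => j _.
  suff -> : coord b j u = 0 by rewrite scale0r.
  rewrite -(coef0 _ j) -pu0 coef_sum (bigD1 j) //= coefZ coefXn eqxx mulr1.
  by rewrite big1 ?addr0 // => k nk; rewrite coefZ coefXn eq_sym val_eqE (negbTE nk) mulr0.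
have /closed_nonrootP[t] : \prod_(i < m) p (w i) != 0.
  by apply/prodf_neq0 => i _; apply: p0; apply: w0.
rewrite rootE horner_prod => /prodf_neq0 pt.
exists (\sum_(j < n) t ^+ j *: linfun (coord b j : W -> K^o)) => i lti.
have := pt (Ordinal lti) isT; congr (_ != 0); rewrite /= sum_lfunE horner_sum.
by apply: eq_bigr => j _; rewrite scale_lfunE lfunE /= hornerZ hornerXn mulrC.
Qed.

Lemma dim_capv_lker L (phi : 'Hom(W, K^o)) : (\dim L <= \dim (L :&: lker phi) + 1)%N.
Proof.
rewrite -[X in (X <= _)%N](limg_ker_dim phi L) leq_add2l.
by rewrite (leq_trans (dimvS (subvf _))) // dimvf.
Qed.

Definition chain_in X k : Prop :=
  has_chain [set Z | proj_irreducible Z /\ Z `<=` X] k.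

(** The hyperplane is chosen to miss a point of every piece [F i], so a chain in the section, lying
    in some [F i], can be prolonged by [F i]. *)
Lemma avoid_subspace k X : proj_closed X -> ~ chain_in X k ->
  exists L, (n <= \dim L + k)%N /\ forall w, X w -> w \notin L.
Proof.
elim: k X => [|k IH] X cX nX; have [m [F [HF XF]]] := closed_decomposable cX.
  (* Without a chain of length 0, [X] is empty. *)
  exists fullv; rewrite addn0; split=> // w /XF[k ltk Fk].
  by case: nX; exists (fun=> F k); split=> // i _; apply: HF.
have /choice[u Hu] : forall i, exists u, (i < m)%N -> F i u /\ u != 0.
  move=> i; case: (ltnP i m) => [lti|]; last by exists 0.
  have [[cF [u Fu] _] _] := HF _ lti; exists u => _; split=> //.
  exact: proj_closed_neq0 cF Fu.
have [|phi Hphi] := @avoid_form u m; first by move=> i /Hu[].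
have cX' : proj_closed (X `&` [set w | w != 0 /\ w \in lker phi]).
  by apply: proj_closedI => //; apply: proj_closed_space.
have [|L [dL HL]] := IH _ cX'.
  move=> [c [Hc ltc]]; have [irrc subc] := Hc k (leqnn k).
  have [i lti sub] : exists2 i, (i < m)%N & c k `<=` F i.
    apply: irreducible_bigcup => // [i lti|w /subc[/XF]//].
    by have [[]] := HF _ lti.
  apply: nX; exists (fun j => if (j <= k)%N then c j else F i); split=> j.
    move=> _; case: ifP => [lejk|_]; last exact: HF.
    have [irrj subj] := Hc j lejk; split=> //; apply: subset_trans subj _.
    by move=> w [].
  rewrite ltnS => lejk; rewrite lejk; case: ltnP => [ltjk|lekj]; first exact: ltc.
  have -> : j = k by apply/eqP; rewrite eqn_leq lejk.
  split=> // sub'; have [Fu u0] := Hu _ lti.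
  have /subc[_ [_]] := sub' _ Fu; rewrite memv_ker.
  by rewrite (negbTE (Hphi _ lti)).
exists (L :&: lker phi)%VS; split; first by have := dim_capv_lker L phi; lia.
move=> w Xw; rewrite memv_cap negb_and; case: (boolP (w \in lker phi)) => wk.
  rewrite HL //; split=> //; split=> //.
  exact: proj_closed_neq0 cX Xw.
by rewrite orbT.
Qed.

(** The equations of [L] become the first coordinates, so that a stage of the tower is the
    coordinate ring of the target of the projection from [L]. *)
Lemma adapted_basis L : exists b : n.-tuple W, basis_of {:W} b /\
  forall w, w \in L <-> forall i : 'I_n, (i < n - \dim L)%N -> coord b i w = 0.
Proof.
pose s := vbasis L^C%VS ++ vbasis L.
have basis_s : basis_of {:W} s.
  have dir : directv (L^C + L)%VS by apply/directv_addP; rewrite capvC capv_compl.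
  have := cat_basis dir (vbasisP _) (vbasisP _).
  by rewrite addvC addv_complf.
have size_s : size s == n by rewrite size_cat !size_tuple dimv_compl subnK // dimvS // subvf.
pose b : n.-tuple W := Tuple size_s.
have bE (i : 'I_n) : b`_i = if (i < n - \dim L)%N then (vbasis L^C%VS)`_i
    else (vbasis L)`_(i - (n - \dim L)).
  by rewrite /= nth_cat (_ : size _ = n - \dim L)%N // size_tuple dimv_compl.
have leLn : (\dim L <= n)%N by rewrite dimvS // subvf.
have mem_b (i : 'I_n) : (n - \dim L <= i)%N -> b`_i \in L.
  move=> lei; rewrite bE ltnNge lei /=; apply: vbasis_mem; apply: mem_nth.
  by rewrite size_tuple; have := ltn_ord i; lia.
exists b; split=> // w; split=> [wL i lti|H]; last first.
  rewrite -(bcoordK (basis_s : basis_of {:W} b) w).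
  apply: memv_suml => i _; case: (ltnP i (n - \dim L)) => [lti|lei].
    by rewrite /bcoord H // scale0r mem0v.
  by rewrite memvZ // mem_b.
rewrite (coord_vbasis wL) linear_sum big1 // => j _; rewrite linearZ /=.
have ltj : ((n - \dim L) + j < n)%N by have := ltn_ord j; lia.
have -> : (vbasis L)`_j = b`_(Ordinal ltj).
  by rewrite bE /= ltnNge leq_addr /= addKn.
rewrite coord_free ?(basis_free basis_s) //.
by case: eqP => [/(congr1 val) /= E|_]; [lia | rewrite mulr0].
Qed.
End Irreducible.

(** * Linear sections *)

Section LinearSections.
Variables (K : numClosedFieldType) (W : vectType K).
Local Notation n := (\dim {:W}).
Implicit Types (w : W) (Z X : set W) (L : {vspace W}).

Section FiniteProjection.
Variables (b : n.-tuple W) (L : {vspace W}) (Z : set W).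
Hypotheses (basisb : basis_of {:W} b) (irrZ : proj_irreducible Z).
Hypothesis adaptb :
  forall w, w \in L <-> forall i : 'I_n, (i < n - \dim L)%N -> coord b i w = 0.
Hypothesis ZL : forall w, Z w -> w \notin L.
Local Notation k := (n - \dim L)%N.
Local Notation P := (vanishing b Z).
Local Notation A := (tower K n k).

Let primeP : is_prime_ideal P := vanishing_prime basisb irrZ.

(** The ideal of [Z] enlarged by the equations of [L]. *)
Let Q : set {mpoly K[n]} := [set f | exists g : 'I_n -> {mpoly K[n]},
  P (f - \sum_(i < n | (i < k)%N) g i * 'X_i)].

Lemma section_ideal : ideal_closed Q.
Proof.
split=> [|f g [p Pp] [q Pq]|a f [p Pp]].
- exists (fun=> 0); rewrite big1 ?subrr //; first exact: prime0 primeP.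
  by move=> i _; rewrite mul0r.
- exists (fun i => p i + q i); under eq_bigr do rewrite mulrDl.
  by rewrite big_split /= opprD addrACA; apply: (primeD primeP).
- exists (fun i => a * p i); under eq_bigr do rewrite -mulrA.
  by rewrite -mulr_sumr -mulrBr; apply: (primeMl primeP).
Qed.

(** Since [Z] misses [L], the only common zero of [Q] is the origin; a prime over [Q] avoiding the
    powers of a variable would provide another. *)
Lemma section_nilpotent (j : 'I_n) : exists N, Q ('X_j ^+ N).
Proof.
apply/not_existsP => nQ; have [Q' [primeQ' sQQ' nQ'j]] := prime_avoid section_ideal nQ.
have [a [aj Qa]] := prime_zero primeQ' nQ'j; rewrite mevalXU in aj.
have aE f : f.@[bcoord b (point b a)] = f.@[a] by apply: meval_eq => i; rewrite pointK.
have w0 : point b a != 0.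
  apply: contraNneq aj => w0; rewrite -(pointK basisb a j) w0.
  by rewrite /bcoord linear0.
have sPQ : P `<=` Q.
  move=> f Pf; exists (fun=> 0); rewrite big1 ?subr0 // => i _.
  by rewrite mul0r.
have Zw : Z (point b a).
  apply: (vanishing_zero basisb _ w0) => [|f Pf]; first by case: irrZ.
  by rewrite aE; apply: Qa; apply: sQQ'; apply: sPQ.
have /negP := ZL Zw; apply; apply/adaptb => i lti.
rewrite -[LHS]/(bcoord b _ i) pointK // -(mevalXU a i); apply: Qa; apply: sQQ'.
exists (fun j => (j == i)%:R); rewrite (bigD1 i) //= eqxx mul1r big1.
  by rewrite addr0 subrr; apply: (prime0 primeP).
by move=> l /andP[_ /negbTE->]; rewrite mul0r.
Qed.

Lemma section_power : exists M, forall m : 'X_{1..n}, (M < mdeg m)%N -> Q 'X_[m].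
Proof.
have [Q0 QD QM] := section_ideal.
have /choice[N HN] := section_nilpotent.
pose N' := (\sum_j N j)%N; exists (n * N')%N => m ltm.
have [j ltj] : exists j, (N j <= m j)%N.
  apply: contrapT => /forallNP nj; move: ltm; rewrite ltnNge => /negP; apply.
  rewrite mdegE -[X in (X * _)%N]card_ord -sum_nat_const; apply: leq_sum => j _.
  have /negP := nj j; rewrite -ltnNge => /ltnW/leq_trans; apply.
  by rewrite /N' (bigD1 j) //= leq_addr.
have -> : m = ((m - U_(j) *+ N j) + U_(j) *+ N j)%MM.
  rewrite submK //; apply/mnm_lepP => i; rewrite mulmnE mnm1E.
  by case: eqP => [<-|_]; rewrite ?mul1n ?mul0n.
by rewrite mpolyXD -mpolyXn; apply: QM.
Qed.

(** A graded Nakayama argument: modulo [P], monomials of degree above [M] are combinations of the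
    coordinates on the target with cofactors of lower degree. *)
Lemma finite_projection : exists M, forall f, exists a : 'X_{1..n < M.+1} -> {mpoly K[n]},
  (forall m, a m \in A) /\ P (f - \sum_m a m * 'X_[m]).
Proof.
have [M HM] := section_power; exists M.
pose Mod f := exists a : 'X_{1..n < M.+1} -> {mpoly K[n]},
  (forall m, a m \in A) /\ P (f - \sum_m a m * 'X_[m]).
have Mod0 : Mod 0.
  exists (fun=> 0); split=> [m|]; first exact: rpred0.
  by rewrite big1 ?subrr => [|m _]; [apply: (prime0 primeP) | rewrite mul0r].
have ModD f g : Mod f -> Mod g -> Mod (f + g).
  move=> [p [Ap Pp]] [q [Aq Pq]]; exists (fun m => p m + q m); split=> [m|].
    exact: rpredD.
  under eq_bigr do rewrite mulrDl.
  by rewrite big_split /= opprD addrACA; apply: (primeD primeP).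
have ModM a f : a \in A -> Mod f -> Mod (a * f).
  move=> Aa [p [Ap Pp]]; exists (fun m => a * p m); split=> [m|]; first exact: rpredM.
  under eq_bigr do rewrite -mulrA.
  by rewrite -mulr_sumr -mulrBr; apply: (primeMl primeP).
have ModP f g : Mod f -> P (g - f) -> Mod g.
  move=> [p [Ap Pp]] Pgf; exists p; split=> //.
  by rewrite -(subrK f g) -addrA; apply: (primeD primeP).
have Mod_sum I (s : seq I) (C : pred I) (F : I -> {mpoly K[n]}) :
    (forall i, C i -> Mod (F i)) -> Mod (\sum_(i <- s | C i) F i).
  by move=> MF; elim/big_ind: _.
have Mod_small m : (mdeg m <= M)%N -> Mod 'X_[m].
  rewrite -ltnS => ltm; exists (fun m' => (m' == m :> 'X_{1..n})%:R); split=> [m'|].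
    by case: eqP => _; rewrite ?rpred1 ?rpred0.
  rewrite (bigD1 (BMultinom ltm)) //= eqxx mul1r big1 ?addr0 ?subrr.
    exact: prime0 primeP.
  by move=> m'; rewrite bmeqP /= => /negbTE->; rewrite mul0r.
have ModX d m : mdeg m = d -> Mod 'X_[m].
  elim: d m => [|d IH] m degm; case: (ltnP M (mdeg m)) => [ltM|leM].
  - by rewrite degm in ltM.
  - exact: Mod_small.
  - move: ltM => /HM[g Pg].
    have cZ : proj_closed Z by case: irrZ.
    (* The ideal of [Z] is homogeneous; the component of degree [d.+1] makes the cofactors
       homogeneous of degree [d], where the induction hypothesis applies. *)
    have := vanishing_pihomog d.+1 cZ Pg.
    have -> : pihomog mdeg d.+1 ('X_[m] - \sum_(i < n | (i < k)%N) g i * 'X_i) =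
        'X_[m] - \sum_(i < n | (i < k)%N) pihomog mdeg d (g i) * 'X_i.
      rewrite linearB /= pihomogX /= degm eqxx; congr (_ - _).
      by rewrite linear_sum; apply: eq_bigr => i _; apply: pihomogMX.
    move=> Pd; apply: (ModP _ _ _ Pd).
    apply: (Mod_sum) => i lti; rewrite mulrC; apply: (ModM); first exact: tower_var.
    rewrite pihomogE; apply: (Mod_sum) => m' /eqP /= degm'.
    by rewrite -mul_mpolyC; apply: (ModM); [apply: tower_const | apply: IH].
  - exact: Mod_small.
move=> f; rewrite [f]mpolyE; apply: (Mod_sum) => m _.
by rewrite -mul_mpolyC; apply: (ModM); [apply: tower_const | apply: ModX].
Qed.

(* An equation f of Z0 divides, modulo the ideal of Z, a nonzero function coming
   from the base of the projection; it would vanish on Z0, hence identically. *)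
Lemma finite_projection_proper (Z0 : set W) : Z0 `<=` Z -> proj_closed Z0 ->
  (forall w, w \notin L -> exists2 l, l \in L & Z0 (w + l)) -> Z `<=` Z0.
Proof.
move=> sZ0 cZ0 surj; apply: contrapT => nsub.
have [f [Z0f nPf]] : exists f, vanishing b Z0 f /\ ~ P f.
  apply: contrapT => nf; apply: nsub => w Zw.
  apply: (vanishing_zero basisb) => // [|f Z0f].
    by apply: proj_closed_neq0 Zw; case: irrZ.
  by apply: contrapT => nfw; apply: nf; exists f; split=> // /(_ w Zw).
have [M HM] := finite_projection.
have lt0 : (mdeg (0%MM : 'X_{1..n}) < M.+1)%N by rewrite mdeg0.
have [||q [mq Aq Pq]] := @integral_modulo_fin _ _ P A primeP _
    (fun m : 'X_{1..n < M.+1} => 'X_[m]) f (BMultinom lt0).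
- by rewrite mpolyX0.
- by move=> m; apply: HM.
have [a [u [Aa _ nPa Pau]]] := integral_divisor primeP mq Aq Pq nPf.
(* An element of [A] takes the same value at [w] and at [w + l], and [f] vanishes at the latter. *)
apply: nPa => w Zw; have [l lL Z0wl] := surj w (ZL Zw).
rewrite (tower_meval (a' := bcoord b (w + l)) Aa) => [|i lti].
  have := Pau _ (sZ0 _ Z0wl); rewrite mevalB mevalM Z0f // mul0r subr0.
  by [].
by rewrite /bcoord linearD /= (proj1 (adaptb l) lL i lti) addr0.
Qed.

(** Surjectivity makes [f] vanish outside [L]. The first coordinate vanishes on [L] because [0 < k],
    so its product with [f] vanishes everywhere. *)
Lemma projection_indep : (0 < k)%N ->
    (forall w, w \notin L -> exists2 l, l \in L & Z (w + l)) ->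
  forall f, f \in A -> P f -> f = 0.
Proof.
move=> k0 surj f Af Pf.
have ltn0 : (0 < n)%N by lia.
have /eqP : f * 'X_(Ordinal ltn0) = 0.
  apply: meval_eq0 => a; rewrite mevalM mevalXU; apply/eqP; rewrite mulf_eq0.
  case: (boolP (point b a \in L)) => [/adaptb H|/surj[l lL Zl]].
    by rewrite -(pointK basisb a) [X in _ || (X == 0)]H ?eqxx ?orbT.
  rewrite (tower_meval (a' := bcoord b (point b a + l)) Af) ?Pf ?eqxx // => i lti.
  rewrite /bcoord linearD /= (proj1 (adaptb l) lL i lti) addr0.
  by rewrite -[RHS]/(bcoord b _ i) pointK.
rewrite mulf_eq0 => /orP[/eqP//|/eqP/(congr1 (fun p => p@_U_(Ordinal ltn0)))].
by rewrite mcoeffXU eqxx mcoeff0 => /eqP; rewrite oner_eq0.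
Qed.

End FiniteProjection.

(** A common point of [Z] and [L + <[w]>] has a nonzero component along [w], as [Z] misses [L], and
    can be rescaled. *)
Lemma meets_translate Z L : proj_closed Z -> (forall w, Z w -> w \notin L) ->
    (forall L', (\dim L < \dim L')%N -> exists2 w, Z w & w \in L') ->
  forall w, w \notin L -> exists2 l, l \in L & Z (w + l).
Proof.
move=> cZ ZL meet w wL.
have [|z Zz] := meet (L + <[w]>)%VS.
  rewrite dimv_disjoint_sum; last first.
    apply/eqP; rewrite -subv0; apply/subvP => u; rewrite memv_cap memv0 => /andP[uL].
    case/vlineP => c uE; move: uL; rewrite uE; have [->|c0] := eqVneq c 0.
      by rewrite scale0r.
    by rewrite rpredZeq (negbTE c0) (negbTE wL).
  rewrite dim_vline -addn1 leq_add2l lt0b.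
  by apply: contraNneq wL => ->; rewrite mem0v.
move=> /memv_addP[l lL [v /vlineP[c ->] zE]].
have c0 : c != 0.
  by apply: contraTneq lL => c0; rewrite -[l]addr0 -(scale0r w) -c0 -zE ZL.
exists (c^-1 *: l); first by rewrite memvZ.
have := proj_closed_scale cZ Zz (invr_neq0 c0); rewrite zE scalerDr scalerA mulVf //.
by rewrite scale1r addrC.
Qed.

Lemma chain_meets (c : nat -> set W) k :
    (forall i, (i <= k)%N -> proj_irreducible (c i)) ->
    (forall i, (i < k)%N -> c i `<` c i.+1) ->
  forall L, (n <= \dim L + k)%N -> exists2 w, c k w & w \in L.
Proof.
elim: k => [|k IH] irrc ltc L dL.
  have [_ [w cw] _] := irrc 0%N isT; exists w => //.
  have /eqP-> : L == fullv by rewrite eqEdim subvf /= -[\dim L]addn0.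
  exact: memvf.
apply: contrapT => nmeet.
have ZL w : c k.+1 w -> w \notin L.
  by move=> cw; apply/negP => wL; apply: nmeet; exists w.
have [sub nsub] := ltc k (ltnSn k).
(* By induction [c k] meets every space larger than [L], so it already surjects under the projection
   from [L]. *)
have meet L' : (\dim L < \dim L')%N -> exists2 w, c k w & w \in L'.
  move=> ltL; apply: IH => [i lei|i lti|]; last by lia.
    by apply: irrc; apply: leqW.
  by apply: ltc; apply: leqW.
have [ck _ _] := irrc k (leqnSn k).
have [b [basisb adaptb]] := adapted_basis L.
apply: nsub; apply: (finite_projection_proper basisb (irrc k.+1 (leqnn _)) adaptb ZL sub ck).
by apply: meets_translate => // w /sub/ZL.
Qed.

(** Otherwise some [L] of codimension at most [p] misses the section, although [M :&: L], of
    codimension at most [p + q], must meet [X]. *)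
Lemma chain_in_section X (M : {vspace W}) p q : proj_closed X ->
  chain_in X (p + q) -> (n <= \dim M + q)%N ->
  chain_in (X `&` [set w | w != 0 /\ w \in M]) p.
Proof.
move=> cX [c [Hc ltc]] dM; apply: contrapT => nch.
have [|L [dL XL]] := avoid_subspace _ nch.
  by apply: proj_closedI => //; apply: proj_closed_space.
have [|||w cw wML] := @chain_meets c (p + q) _ _ (M :&: L)%VS.
- by move=> i lei; case: (Hc i lei).
- exact: ltc.
- by have := dimv_sum_cap M L; have := dimvS (subvf (M + L)%VS); lia.
have [_ sub] := Hc _ (leqnn (p + q)%N); have Xw := sub w cw.
move: wML; rewrite memv_cap => /andP[wM wL]; have := XL w; rewrite wL => H.
by have: ~~ true by apply: H; split=> //; split=> //; apply: proj_closed_neq0 cX Xw.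
Qed.

End LinearSections.

(** * Minors *)

Section LineDerivative.
Variables (K : numClosedFieldType) (n : nat).

Definition dirderiv (f : {mpoly K[n]}) (a v : 'I_n -> K) : K :=
  \sum_k f^`M(k).@[a] * v k.

Lemma dirderivD f g a v : dirderiv (f + g) a v = dirderiv f a v + dirderiv g a v.
Proof.
by rewrite -big_split; apply: eq_bigr => k _; rewrite mderivD mevalD mulrDl.
Qed.

Lemma dirderivM f g a v :
  dirderiv (f * g) a v = dirderiv f a v * g.@[a] + f.@[a] * dirderiv g a v.
Proof.
rewrite mulr_suml mulr_sumr -big_split; apply: eq_bigr => k _ /=.
by rewrite mderivM mevalD !mevalM; ring.
Qed.

Lemma dirderivZ c f a v : dirderiv (c *: f) a v = c * dirderiv f a v.
Proof.
by rewrite mulr_sumr; apply: eq_bigr => k _; rewrite mderivZ mevalZ mulrA.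
Qed.

Lemma dirderivX i a v : dirderiv 'X_i a v = v i.
Proof.
rewrite /dirderiv (bigD1 i) //= big1 ?addr0 => [|k /negbTE nk].
  rewrite mderivX mnm1E eqxx scale1r (_ : (U_(i) - U_(i))%MM = 0%MM).
    by rewrite mpolyX0 meval1 mul1r.
  by apply/mnmP => j; rewrite mnmBE mnm0E subnn.
by rewrite mderivX mnm1E eq_sym nk scale0r meval0 mul0r.
Qed.

(** Reduces derivatives to one-variable restrictions, so that minors are differentiated only along
    pencils [e + t *: M]. *)
Lemma dirderiv_line (f : {mpoly K[n]}) (a v : 'I_n -> K) (p : {poly K}) :
  (forall t, p.[t] = f.@[fun i => a i + t * v i]) -> p`_1 = dirderiv f a v.
Proof.
pose good g := exists q : {poly K},
  (forall t, q.[t] = g.@[fun i => a i + t * v i]) /\ q`_1 = dirderiv g a v.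
have at0 q (g : {mpoly K[n]}) :
    (forall t, q.[t] = g.@[fun i => a i + t * v i]) -> q`_0 = g.@[a].
  by move=> qE; rewrite -horner_coef0 qE; apply: meval_eq => i; rewrite mul0r addr0.
have goodM g h : good g -> good h -> good (g * h).
  move=> [q [qE q1]] [r [rE r1]]; exists (q * r); split=> [t|].
    by rewrite hornerM qE rE mevalM.
  rewrite coefM big_ord_recl big_ord1 /= subn0 subnn q1 r1 dirderivM.
  by rewrite (at0 _ _ qE) (at0 _ _ rE) addrC.
have goodD g h : good g -> good h -> good (g + h).
  move=> [q [qE q1]] [r [rE r1]]; exists (q + r); split=> [t|].
    by rewrite hornerD qE rE mevalD.
  by rewrite coefD q1 r1 dirderivD.
have goodC c : good c%:MP.
  exists c%:P; split=> [t|]; first by rewrite hornerC mevalC.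
  by rewrite coefC /dirderiv big1 // => k _; rewrite mderivC meval0 mul0r.
have goodX i : good 'X_i.
  exists ((a i)%:P + v i *: 'X); split=> [t|].
    by rewrite hornerD hornerC hornerZ hornerX mevalXU mulrC.
  by rewrite coefD coefC coefZ coefX mulr1 add0r dirderivX.
have [q [qE q1]] : good f.
  rewrite [f]mpolyE; apply: (big_ind good) => [||m _]; first exact: (goodC 0).
    exact: (goodD).
  rewrite -mul_mpolyC; apply: (goodM) => //; rewrite mpolyXE_id.
  apply: (big_ind good) => [||i _]; first exact: (goodC 1).
    exact: (goodM).
  by elim: (m i) => [|k IH]; rewrite ?expr0 ?exprS; [apply: (goodC 1) | apply: (goodM)].
move=> pE; rewrite -q1 (_ : p = q) //; apply/eqP; rewrite -subr_eq0; apply/eqP.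
by apply: poly_neq0_val => t _; rewrite hornerD hornerN pE qE subrr.
Qed.

End LineDerivative.

Section DetModSquare.
Variable K : fieldType.

Lemma det_mod_X2 k (A B : 'M[{poly K}]_k) :
  (forall i j, 'X^2 %| A i j - B i j) -> 'X^2 %| \det A - \det B.
Proof.
move=> dAB; rewrite /determinant -sumrB; apply: (big_ind (fun x => 'X^2 %| x)) => [||s _].
- exact: dvdp0.
- by move=> x y; exact: dvdp_add.
rewrite -mulrBr dvdp_mull //; elim/big_rec2: _ => [|i x y _ IH].
  by rewrite subrr dvdp0.
rewrite (_ : _ - _ = (A i (s i) - B i (s i)) * y + B i (s i) * (y - x)); last by ring.
by apply: dvdp_add; [apply: dvdp_mulr | apply: dvdp_mull].
Qed.

End DetModSquare.

Section Minors.
Variables (K : numClosedFieldType) (U C : vectType K).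
Local Notation W := 'Hom(U, C).
Local Notation n := (\dim {:W}).
Implicit Types (e g M : W) (r : nat).

Definition minor r (phi : 'I_r.+1 -> 'Hom(C, K^o)) (psi : 'I_r.+1 -> U) g : K :=
  \det (\matrix_(i, j) (phi i (g (psi j)) : K)).

Lemma minor_rank_le r (phi : 'I_r.+1 -> 'Hom(C, K^o)) (psi : 'I_r.+1 -> U) g :
  (rank g <= r)%N -> minor phi psi g = 0.
Proof.
move=> rg; pose X := [tuple g (psi j) | j < r.+1].
have nX : ~~ free X.
  apply/negP => /eqP fX; move: rg; rewrite leqNgt => /negP; apply.
  rewrite -[X in (X <= _)%N](size_tuple X) -fX; apply: dimvS.
  apply/span_subvP => y /mapP[j _ ->]; exact: memv_img (memvf _).
have [c [Xc [j cj]]] : exists c : 'I_r.+1 -> K,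
    \sum_i c i *: X`_i = 0 /\ exists j, c j != 0.
  apply: contrapT => nc; case/negP: nX; apply/freeP => c Xc j.
  by apply/eqP; apply: contrapT => /negP cj; apply: nc; exists c; split=> //; exists j.
apply/eqP; apply: contraT => nd.
pose A := \matrix_(i, j) (phi i (g (psi j)) : K).
have uA : A \in unitmx by rewrite unitmxE unitfE.
have : A *m \col_j c j = 0.
  apply/matrixP => i z; rewrite !mxE; have := congr1 (phi i) Xc.
  rewrite linear_sum linear0 => E; rewrite -[RHS]E; apply: eq_bigr => k _.
  by rewrite !mxE linearZ -[X`_k](tnth_nth 0 X k) tnth_mktuple mulrC.
move/(congr1 (mulmx (invmx A))); rewrite mulKmx // mulmx0 => /matrixP/(_ j 0).
by rewrite !mxE => /eqP; rewrite (negbTE cj).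
Qed.

Lemma coord_limg g (k : nat) : (k <= rank g)%N ->
  exists (phi : 'I_k -> 'Hom(C, K^o)) (psi : 'I_k -> U),
    forall i j, phi i (g (psi j)) = (i == j)%:R.
Proof.
move=> lek; set b := vbasis (limg g).
exists (fun i => linfun (coord b (widen_ord lek i) : C -> K^o)).
exists (fun j => (g^-1)%VF b`_j) => i j; rewrite lfunE /= limg_lfunVK.
  rewrite -[j : nat]/(widen_ord lek j : nat) coord_free ?(basis_free (vbasisP _)) //.
  by rewrite -val_eqE /= val_eqE eq_sym.
by apply: vbasis_mem; apply: mem_nth; rewrite size_tuple (leq_trans (ltn_ord j)).
Qed.

Lemma minor_rank_gt r g : (r < rank g)%N -> exists phi psi, minor (r := r) phi psi g != 0.
Proof.
move=> /coord_limg[phi [psi H]]; exists phi, psi.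
rewrite /minor (_ : \matrix_(i, j) _ = 1%:M) ?det1 ?oner_eq0 //.
by apply/matrixP => i j; rewrite !mxE H.
Qed.

Definition line_minor r (phi : 'I_r.+1 -> 'Hom(C, K^o)) (psi : 'I_r.+1 -> U) e M : {poly K} :=
  \det (\matrix_(i, j) ((phi i (e (psi j)) : K)%:P + (phi i (M (psi j)) : K) *: 'X)).

Lemma line_minorE r (phi : 'I_r.+1 -> 'Hom(C, K^o)) (psi : 'I_r.+1 -> U) e M t :
  (line_minor phi psi e M).[t] = minor phi psi (e + t *: M).
Proof.
rewrite -[LHS]/(horner_eval t _) -det_map_mx; congr (\det _).
apply/matrixP => i j; rewrite !mxE /= /horner_eval hornerD hornerC hornerZ hornerX.
by rewrite add_lfunE scale_lfunE linearD linearZ /= mulrC.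
Qed.

(** [Y] is chosen through a partial inverse of [e] so that [e \o Y] agrees with [M] on the kernel of
    [e]; the difference then factors through [e]. *)
Lemma neutral_decomp e M : neutral e M ->
  exists (X : 'End(C)) (Y : 'End(U)), M = ((X \o e) + (e \o Y))%VF.
Proof.
move=> nM; pose Y := ((e^-1) \o M \o projv (lker e))%VF.
pose X := ((M - (e \o Y)) \o e^-1)%VF; exists X, Y.
have eY u : u \in lker e -> e (Y u) = M u.
  move=> uk; rewrite /Y !comp_lfunE projv_id // limg_lfunVK //.
  by apply: (subvP nM); apply: memv_img.
have XE c : X c = M ((e^-1)%VF c) - e (Y ((e^-1)%VF c)).
  by rewrite /X comp_lfunE add_lfunE opp_lfunE comp_lfunE.
apply/lfunP => u; rewrite add_lfunE (comp_lfunE X e) (comp_lfunE e Y) XE.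
set u' := (e^-1)%VF (e u).
have ku : u' - u \in lker e.
  by rewrite memv_ker linearB /= limg_lfunVK ?memv_img ?memvf // subrr.
have -> : u' = u + (u' - u) by rewrite addrC subrK.
rewrite [M (_ + _)]linearD [Y (_ + _)]linearD [e (_ + _)]linearD /= (eY _ ku).
by rewrite opprD addrACA subrr addr0 subrK.
Qed.

Lemma rank_comp_le (X : 'End(C)) (Y : 'End(U)) e : (rank (X \o e \o Y)%VF <= rank e)%N.
Proof.
rewrite /rank !limg_comp; apply: leq_trans (dimvS (limgS _ (limgS _ (subvf _)))) _.
by rewrite -(limg_ker_dim X (limg e)) leq_addl.
Qed.

(* e + t (X e + e Y) agrees modulo t^2 with (1 + t X) e (1 + t Y), whose rank is
   at most the rank of e. *)
Lemma line_minor_neutral r (phi : 'I_r.+1 -> 'Hom(C, K^o)) (psi : 'I_r.+1 -> U) e M :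
  (rank e <= r)%N -> neutral e M -> (line_minor phi psi e M)`_1 = 0.
Proof.
move=> re /neutral_decomp[X [Y ME]].
pose G : 'M[{poly K}]_r.+1 := \matrix_(i, j) ((phi i (e (psi j)) : K)%:P
   + (phi i (M (psi j)) : K) *: 'X + (phi i (X (e (Y (psi j)))) : K) *: 'X^2).
have G0 : \det G = 0.
  apply: poly_neq0_val => t _.
  rewrite -[LHS]/(horner_eval t _) -det_map_mx.
  rewrite -(minor_rank_le phi psi (g := ((\1 + t *: X) \o e \o (\1 + t *: Y))%VF)); last first.
    exact: leq_trans (rank_comp_le _ _ _) re.
  congr (\det _); apply/matrixP => i j; rewrite !mxE /= /horner_eval.
  rewrite !hornerD hornerC !hornerZ hornerX hornerXn ME.
  rewrite !(comp_lfunE, add_lfunE, scale_lfunE, id_lfunE).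
  rewrite !(linearD, linearZ) /= !(linearD, linearZ) /=.
  rewrite /GRing.scale /=; ring.
have := @det_mod_X2 _ _ (\matrix_(i, j) ((phi i (e (psi j)) : K)%:P
   + (phi i (M (psi j)) : K) *: 'X)) G.
rewrite G0 subr0 -/(line_minor phi psi e M) => H.
have /dvdpP[q ->] : 'X^2 %| line_minor phi psi e M.
  apply: H => i j; rewrite !mxE opprD addrA subrr sub0r dvdpNr.
  by rewrite -mul_polyC dvdp_mull.
by rewrite coefMXn.
Qed.

(** An invertible block of size [r] is bordered by the column of [u] and the row of [phi0], both
    zero for [e]; the first-order term is then the corner entry. *)
Lemma minor_detects r e (phi0 : 'Hom(C, K^o)) u : rank e = r ->
    u \in lker e -> (limg e <= lker phi0)%VS ->
  exists (phi : 'I_r.+1 -> 'Hom(C, K^o)) (psi : 'I_r.+1 -> U),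
    forall M, (line_minor phi psi e M)`_1 = phi0 (M u).
Proof.
move=> re uk /subvP phi0e.
have [|phi1 [psi1 H]] := @coord_limg e r; first by rewrite re.
pose phi (i : 'I_(1 + r)) := if split i is inr i' then phi1 i' else phi0.
pose psi (i : 'I_(1 + r)) := if split i is inr i' then psi1 i' else u.
exists phi, psi => M.
have eu : e u = 0 by apply/eqP; rewrite -memv_ker.
have phi0e0 j : phi0 (e (psi1 j)) = 0.
  by apply/eqP; rewrite -memv_ker; apply: phi0e; apply: memv_img; apply: memvf.
(* The first column of the matrix is divisible by ['X] because [e u = 0]. Dividing it out gives [N],
   which is block triangular at [0]. *)
pose N : 'M[{poly K}]_(1 + r) := block_mx
  (phi0 (M u) : K)%:P%:M (\row_j ((phi0 (M (psi1 j)) : K) *: 'X))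
  (\col_i (phi1 i (M u) : K)%:P)
  (\matrix_(i, j) ((i == j)%:R%:P + (phi1 i (M (psi1 j)) : K) *: 'X)).
have -> : line_minor phi psi e M = \det N * 'X.
  have -> : 'X = \det (block_mx 'X%:M 0 0 1%:M : 'M[{poly K}]_(1 + r)).
    by rewrite det_ublock det_scalar1 det1 mulr1.
  rewrite -det_mulmx mulmx_block !mulmx0 !mulmx1 !addr0 !add0r.
  congr (\det _); apply/matrixP => i j; rewrite !mxE.
  rewrite /phi /psi; case: (@split 1 r i) => i'; rewrite !mxE; case: (@split 1 r j) => j'.
  - rewrite !mxE eu linear0 add0r big_ord1 !mxE !ord1 eqxx !mulr1n.
    by rewrite mul_polyC.
  - by rewrite !mxE phi0e0 add0r.
  - by rewrite !mxE big_ord1 !mxE (ord1 j') eqxx mulr1n eu linear0 add0r mul_polyC.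
  - by rewrite !mxE H.
rewrite coefMX /= -horner_coef0 -[LHS]/(horner_eval 0 _) -det_map_mx map_block_mx.
rewrite (_ : map_mx _ (\row_j _) = 0); last first.
  by apply/matrixP => i j; rewrite !mxE /= /horner_eval hornerZ hornerX mulr0.
rewrite det_lblock (_ : map_mx _ (\matrix_(i, j) _) = 1%:M).
  by rewrite det1 mulr1 det_mx11 !mxE /= /horner_eval mulr1n hornerC.
apply/matrixP => i j; rewrite !mxE /= /horner_eval hornerD hornerC hornerZ hornerX.
by rewrite mulr0 addr0.
Qed.

End Minors.

(** * Rank loci as closed sets and their tangent vectors *)

Section RankLocus.
Variables (K : numClosedFieldType) (U C : vectType K).
Local Notation W := 'Hom(U, C).
Local Notation n := (\dim {:W}).
Implicit Types (e w M : W) (r : nat) (b : n.-tuple W) (E : {vspace W}).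

Definition pairing (phi : 'Hom(C, K^o)) (u : U) (w : W) : K^o := phi (w u).

Lemma pairing_linear phi u : linear (pairing phi u).
Proof. by move=> a w w'; rewrite /pairing add_lfunE scale_lfunE linearP. Qed.

HB.instance Definition _ phi u :=
  GRing.isLinear.Build K W K^o _ (pairing phi u) (pairing_linear phi u).

Definition minor_poly b r (phi : 'I_r.+1 -> 'Hom(C, K^o)) (psi : 'I_r.+1 -> U) :
  {mpoly K[n]} := \det (\matrix_(i, j) lform b (pairing (phi i) (psi j))).

Lemma minor_poly_eval b r (phi : 'I_r.+1 -> 'Hom(C, K^o)) psi w : basis_of {:W} b ->
  (minor_poly b phi psi).@[bcoord b w] = minor phi psi w.
Proof.
move=> basisb; rewrite -det_map_mx; congr (\det _); apply/matrixP => i j.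
by rewrite !mxE /= lform_eval.
Qed.

Lemma minor_poly_homog b r (phi : 'I_r.+1 -> 'Hom(C, K^o)) psi :
  minor_poly b phi psi \is r.+1.-homog.
Proof.
rewrite rpred_sum // => s _; rewrite rpredMsign.
have := @dhomog_bigprod K n _ (index_enum 'I_r.+1) (fun=> 1%N)
  (fun i => (\matrix_(i, j) lform b (pairing (phi i) (psi j))) i (s i)).
rewrite sum1_card card_ord; apply=> i; rewrite mxE; exact: lform_homog.
Qed.

Lemma rank_leP r w :
  (rank w <= r)%N <-> forall (phi : 'I_r.+1 -> 'Hom(C, K^o)) psi, minor phi psi w = 0.
Proof.
split=> [rw phi psi|H]; first exact: minor_rank_le.
rewrite leqNgt; apply/negP => /minor_rank_gt[phi [psi]].
by rewrite H eqxx.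
Qed.

Lemma rank_locus_closed r E : proj_closed (rank_locus r E).
Proof.
apply: proj_closedI; first exact: proj_closed_space.
have basisv := vbasisP {:W}; apply/(proj_closedP _ basisv).
exists [set f | exists (phi : 'I_r.+1 -> 'Hom(C, K^o)) psi,
  f = minor_poly (vbasis {:W}) phi psi]; split.
  by move=> _ [phi [psi ->]]; exists r.+1; apply: minor_poly_homog.
apply/seteqP; split=> w [w0 H]; split=> //.
  by move=> _ [phi [psi ->]]; rewrite minor_poly_eval // minor_rank_le.
apply/rank_leP => phi psi; rewrite -(minor_poly_eval _ _ _ basisv).
by apply: H; exists phi, psi.
Qed.

(** The linear equations of [E] and the bordered minors at [e] vanish on [Z]; their differentials at
    [e] cut out exactly these two conditions. *)
Lemma tangent_neutral b r E e M (Z : set W) : basis_of {:W} b ->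
    Z `<=` rank_locus r E -> Z e -> rank e = r ->
    (forall f, vanishing b Z f -> dirderiv f (bcoord b e) (bcoord b M) = 0) ->
  M \in E /\ neutral e M.
Proof.
move=> basisb sZ Ze re tanM.
have line t : (fun i => bcoord b e i + t * bcoord b M i) =1 bcoord b (e + t *: M).
  by move=> i; rewrite /bcoord linearD linearZ.
split.
  apply/subspace_formP => i; set phi := subspace_form E i.
  rewrite -(tanM (lform b phi)) => [|w /sZ[[_ /subspace_formP wE] _]]; last first.
    by rewrite lform_eval //; apply: wE.
  rewrite -(@dirderiv_line _ _ _ _ _ ((phi e)%:P + (phi M : K) *: 'X)) => [|t].
    by rewrite coefD coefC coefZ coefX mulr1 add0r.
  rewrite (meval_eq _ (line t)) lform_eval // hornerD hornerC hornerZ hornerX.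
  by rewrite linearD linearZ /= mulrC.
apply/subvP => _ /memv_imgP[u uk ->]; apply/subspace_formP => i.
pose phi0 : 'Hom(C, K^o) := linfun (subspace_form (limg e) i).
have [|phi [psi det]] := @minor_detects _ _ _ r e phi0 u re uk.
  apply/subvP => y ye; rewrite memv_ker lfunE; apply/eqP.
  by move/subspace_formP: ye.
have := det M; rewrite lfunE => <-.
rewrite (@dirderiv_line _ _ (minor_poly b phi psi) (bcoord b e) (bcoord b M)) => [|t].
  apply: tanM => w /sZ[_ [_ rw]]; rewrite minor_poly_eval //.
  exact: minor_rank_le.
by rewrite (meval_eq _ (line t)) minor_poly_eval // line_minorE.
Qed.

Lemma rank_locus_section r E E' : (E <= E')%VS ->
  exists M : {vspace W}, (\dim M + (\dim E' - \dim E) = n)%N /\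
    rank_locus r E = rank_locus r E' `&` [set w | w != 0 /\ w \in M].
Proof.
(* Section results concern subspaces of the whole space; adding a complement of [E'] to [E]
   preserves both the codimension and the trace on [E']. *)
move=> sEE'; exists (E + E'^C)%VS.
have cap : (E' :&: (E + E'^C) = E)%VS.
  apply/eqP; rewrite eqEsubv; apply/andP; split; last first.
    by rewrite subv_cap sEE' addvSl.
  apply/subvP => w; rewrite memv_cap => /andP[wE' /memv_addP[u uE [v vC wE]]].
  suff v0 : v = 0 by rewrite wE v0 addr0.
  apply/eqP; rewrite -memv0 -(capv_compl E') memv_cap vC andbT.
  by rewrite -(addKr u v) addrC -wE rpredB // (subvP sEE').
have dE := dimvS sEE'; have dE' := dimvS (subvf E').
split.
  rewrite dimv_disjoint_sum ?dimv_compl; first lia.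
  apply/eqP; rewrite -subv0 -(capv_compl E') subv_cap capvSr andbT.
  by apply: subv_trans (capvSl _ _) sEE'.
apply/seteqP; split=> w.
  move=> [[w0 wE] rw]; split; first by split=> //; split=> //; apply: subvP wE.
  by split=> //; apply: subvP wE; apply: addvSl.
by move=> [[[w0 wE'] rw] [_ wM]]; split=> //; split=> //; rewrite -cap memv_cap wE'.
Qed.

End RankLocus.

(** * Affine charts *)

Section Chart.
Variables (K : numClosedFieldType) (U C : vectType K).
Local Notation W := 'Hom(U, C).
Local Notation n := (\dim {:W}).
Variables (r m : nat) (E : {vspace W}) (e : W) (h : m.-tuple W).
Hypotheses (basisE : basis_of E (e :: h)) (re : (rank e <= r)%N).

Definition chart_dir (t : 'I_m -> K) : W := \sum_k t k *: tnth h k.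

Lemma chart_minor_eval (phi : 'I_r.+1 -> 'Hom(C, K^o)) psi t :
  (chart_minor e h phi psi).@[t] = minor phi psi (e + chart_dir t).
Proof.
rewrite -det_map_mx; congr (\det _); apply/matrixP => i j.
rewrite !mxE /= mevalD mevalC add_lfunE linearD /=; congr (_ + _).
rewrite rmorph_sum sum_lfunE linear_sum; apply: eq_bigr => k _ /=.
by rewrite mevalZ mevalXU scale_lfunE linearZ /= mulrC.
Qed.

Lemma chart_dirZ s t : chart_dir (fun k => s * t k) = s *: chart_dir t.
Proof. by rewrite scaler_sumr; apply: eq_bigr => k _; rewrite scalerA. Qed.

Lemma chart_minor_dirderiv (phi : 'I_r.+1 -> 'Hom(C, K^o)) psi t :
  neutral e (chart_dir t) ->
  dirderiv (chart_minor e h phi psi) (fun=> 0) t = 0.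
Proof.
move=> nt; rewrite -(@dirderiv_line _ _ _ _ _ (line_minor phi psi e (chart_dir t))).
  exact: line_minor_neutral.
move=> s; rewrite line_minorE -chart_dirZ -chart_minor_eval.
by apply: meval_eq => k; rewrite add0r.
Qed.

Lemma dirderiv_sum I (s : seq I) (F : I -> {mpoly K[m]}) a v :
  dirderiv (\sum_(i <- s) F i) a v = \sum_(i <- s) dirderiv (F i) a v.
Proof.
elim: s => [|i s IH]; last by rewrite !big_cons dirderivD IH.
by rewrite !big_nil /dirderiv big1 // => k _; rewrite mderiv0 meval0 mul0r.
Qed.

(** Neutral directions kill the differentials of the minors and the square of the maximal ideal,
    hence act on the cotangent space. *)
Lemma cotangent_dirderiv t f : neutral e (chart_dir t) ->
  ideal_generated (chart_ideal r e h `|`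
    [set f * g | f in @origin_ideal K m & g in @origin_ideal K m]) f ->
  dirderiv f (fun=> 0) t = 0.
Proof.
move=> nt.
have gen0 (G : set {mpoly K[m]}) : (forall g, G g -> g.@[fun=> 0] = 0) ->
    (forall g, G g -> dirderiv g (fun=> 0) t = 0) ->
    forall g, ideal_generated G g -> g.@[fun=> 0] = 0 /\ dirderiv g (fun=> 0) t = 0.
  move=> G0 G1 _ [k [a [g [Gg ->]]]]; split.
    rewrite rmorph_sum big1 //= => i _; by rewrite mevalM (G0 (g i)) ?mulr0.
  rewrite (dirderiv_sum _ (fun i => a i * g i)) big1 // => i _.
  by rewrite dirderivM (G0 (g i)) // (G1 (g i)) // !mulr0 addr0.
have J0 g : chart_ideal r e h g -> g.@[fun=> 0] = 0 /\ dirderiv g (fun=> 0) t = 0.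
  apply: gen0 => [_ [phi [psi ->]]|_ [phi [psi ->]]]; last exact: chart_minor_dirderiv.
  rewrite chart_minor_eval minor_rank_le // /chart_dir big1 ?addr0 // => k _.
  by rewrite scale0r.
move=> Nf; apply: (proj2 (gen0 _ _ _ _ Nf)) => g [Jg|[p p0 [q q0 <-]]].
- by have [] := J0 g Jg.
- by rewrite mevalM p0 mul0r.
- by have [] := J0 g Jg.
- by rewrite dirderivM p0 q0 mulr0 mul0r addr0.
Qed.

Definition chart_coord (i : 'I_m.+1) : {linear W -> K^o} := coord [tuple of e :: h] i.

Lemma chart_decomp M : M \in E ->
  M = chart_coord ord0 M *: e + chart_dir (fun k => chart_coord (lift ord0 k) M).
Proof.
move=> ME; have basis_eh : basis_of E [tuple of e :: h] := basisE.
rewrite {1}(coord_basis basis_eh ME) big_ord_recl; congr (_ + _).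
by apply: eq_bigr => k _; rewrite (tnth_nth 0).
Qed.

Lemma chart_coord0 t : chart_coord ord0 (e + chart_dir t) = 1.
Proof.
have fr := basis_free basisE.
rewrite linearD linear_sum big1 => [|k _].
  rewrite addr0 -[X in chart_coord _ X]/([tuple of e :: h]`_(@ord0 m)).
  by rewrite [LHS]coord_free.
rewrite linearZ /= (tnth_nth 0) -[h`_k]/([tuple of e :: h]`_(lift ord0 k)).
by rewrite [coord _ _ _]coord_free //= scaler0.
Qed.

Lemma chart_coordS t k : chart_coord (lift ord0 k) (e + chart_dir t) = t k.
Proof.
have fr := basis_free basisE.
rewrite linearD linear_sum (bigD1 k) //= big1 => [|j nj].
  rewrite addr0 -[X in coord _ _ X + _]/([tuple of e :: h]`_(@ord0 m)).
  rewrite coord_free // add0r linearZ /= (tnth_nth 0).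
  rewrite -[h`_k]/([tuple of e :: h]`_(lift ord0 k)).
  rewrite coord_free // eqxx; exact: mulr1.
rewrite linearZ /= (tnth_nth 0) -[h`_j]/([tuple of e :: h]`_(lift ord0 j)).
rewrite coord_free // (inj_eq lift_inj) (negbTE nj); exact: mulr0.
Qed.

(** [T] embeds by the coordinate along [e] and the derivatives of the [d] cotangent generators. The
    extra 1 is the direction of the cone through [e]. *)
Lemma cotangent_bound d (T : {vspace W}) :
    cotangent_dim (chart_ideal r e h) (@origin_ideal K m) d ->
    (T <= E)%VS -> (forall M, M \in T -> neutral e M) ->
  (\dim T <= d.+1)%N.
Proof.
move=> [x [x0 xgen _]] sTE nT.
pose Phi0 (M : W) : 'rV[K]_(1 + d) := row_mx (chart_coord ord0 M)%:M
  (\row_i dirderiv (x i) (fun=> 0) (fun k => chart_coord (lift ord0 k) M)).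
have Phi_lin : linear Phi0.
  move=> c M N; rewrite scale_row_mx add_row_mx; congr row_mx.
    by apply/matrixP => i j; rewrite !mxE linearP /= mulrnDl -mulrnAr.
  apply/rowP => i; rewrite !mxE mulr_sumr -big_split; apply: eq_bigr => k _ /=.
  by rewrite linearP /= mulrDr mulrCA.
pose PhiL := GRing.isLinear.Build K W 'rV[K]_(1 + d) _ Phi0 Phi_lin.
pose Phi := linfun (HB.pack Phi0 PhiL : {linear W -> 'rV[K]_(1 + d)}).
have ker0 : (T :&: lker Phi = 0)%VS.
  apply/eqP; rewrite -subv0; apply/subvP => M; rewrite memv_cap memv_ker memv0.
  move=> /andP[MT]; rewrite lfunE /= => /eqP PhiM.
  have ME := subvP sTE _ MT; set t := fun k => chart_coord (lift ord0 k) M.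
  have M0 : chart_coord ord0 M = 0.
    move/rowP/(_ (lshift d ord0)): PhiM; rewrite row_mxEl !mxE eqxx mulr1n.
    by [].
  have Mdir : M = chart_dir t by rewrite [LHS](chart_decomp ME) M0 scale0r add0r.
  have nt : neutral e (chart_dir t) by rewrite -Mdir; apply: nT.
  have xt i : dirderiv (x i) (fun=> 0) t = 0.
    by move/rowP/(_ (rshift 1 i)): PhiM; rewrite row_mxEr !mxE.
  rewrite Mdir /chart_dir big1 // => k _.
  have [c Nk] : exists c : 'I_d -> K, ideal_generated (chart_ideal r e h `|`
      [set f * g | f in @origin_ideal K m & g in @origin_ideal K m])
      ('X_k - \sum_(i < d) c i *: x i).
    by apply: xgen; rewrite /origin_ideal /= mevalXU.
  have := cotangent_dirderiv nt Nk.
  rewrite -scaleN1r dirderivD dirderivZ dirderivX dirderiv_sum big1 ?mulr0 ?addr0.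
    by move=> ->; rewrite scale0r.
  by move=> i _; rewrite dirderivZ xt mulr0.
rewrite -(limg_ker_dim Phi T) ker0 dimv0 add0n.
by rewrite (leq_trans (dimvS (subvf _))) // dimvf /dim /= mul1n.
Qed.

Local Notation b := (vbasis {:W}).

Definition on_chart (F : {mpoly K[n]}) : {mpoly K[m]} :=
  F \mPo [tuple (coord b i e)%:MP + \sum_k coord b i (tnth h k) *: 'X_k | i < n].

Lemma on_chart_eval F t : (on_chart F).@[t] = F.@[bcoord b (e + chart_dir t)].
Proof.
rewrite comp_mpoly_meval; apply: meval_eq => i; rewrite tnth_mktuple.
rewrite mevalD mevalC /bcoord linearD /=; congr (_ + _).
rewrite rmorph_sum linear_sum; apply: eq_bigr => k _ /=.
by rewrite mevalZ mevalXU linearZ /= mulrC.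
Qed.

Lemma homogenize f : exists (F : {mpoly K[n]}) d, F \is d.-homog /\ on_chart F = f.
Proof.
pose D := msize f.
pose l i := lform b (chart_coord i).
(* The coordinate along [e] equals [1] on the chart, and its powers pad every monomial to degree
   [D], which exceeds the degrees in [f]. *)
pose F : {mpoly K[n]} := \sum_(u <- msupp f) f@_u *:
   (l ord0 ^+ (D - mdeg u) * \prod_(k < m) l (lift ord0 k) ^+ u k).
exists F, D; split.
  rewrite /F big_seq rpred_sum // => u /msize_mdeg_lt ltu; rewrite rpredZ //.
  have lX i k : l i ^+ k \is k.-homog.
    by rewrite -[k in k.-homog]mul1n; apply: dhomogMn; apply: lform_homog.
  have := dhomogM (lX ord0 (D - mdeg u)%N)
    (dhomog_bigprod (index_enum 'I_m) (fun k => lX (lift ord0 k) (u k))).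
  by rewrite -mdegE subnK // ltnW.
apply/eqP; rewrite -subr_eq0; apply/eqP/meval_eq0 => t.
have lE i w : (l i).@[bcoord b w] = chart_coord i w by rewrite lform_eval // vbasisP.
rewrite mevalB on_chart_eval; apply/eqP; rewrite subr_eq0; apply/eqP.
rewrite [f in RHS]mpolyE !rmorph_sum; apply: eq_bigr => u _ /=.
rewrite !mevalZ mevalM mevalX rmorphXn rmorph_prod /= lE chart_coord0 expr1n mul1r.
congr (_ * _); apply: eq_bigr => k _.
by rewrite rmorphXn /= lE chart_coordS.
Qed.

(* The closure in P(E) of the zero set of p in the chart. *)
Definition chart_closure (p : set {mpoly K[m]}) : set W :=
  [set w | w != 0 /\ forall F, (exists d, F \is d.-homog) ->
     p (on_chart F) -> F.@[bcoord b w] = 0].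

Lemma chart_closure_closed p : proj_closed (chart_closure p).
Proof.
apply/(proj_closedP _ (vbasisP {:W})).
exists [set F | (exists d, F \is d.-homog) /\ p (on_chart F)]; split=> [F []//|].
apply/seteqP; split=> w [w0 H]; split=> //; first by move=> F []; apply: H.
by move=> F hF pF; apply: H.
Qed.

Lemma chart_neq0 t : e + chart_dir t != 0.
Proof.
apply/eqP => e0; have := chart_coord0 t; rewrite e0 linear0 => /esym/eqP.
by rewrite oner_eq0.
Qed.

Lemma chart_closure_mem p t : (forall f, p f -> f.@[t] = 0) ->
  chart_closure p (e + chart_dir t).
Proof.
move=> pt; split=> [|F _ pF]; first exact: chart_neq0.
by rewrite -on_chart_eval pt.
Qed.

Lemma chart_closureS p q : p `<=` q -> chart_closure q `<=` chart_closure p.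
Proof. by move=> spq w [w0 H]; split=> // F hF /spq; apply: H. Qed.

Lemma chart_closure_irreducible p : is_prime_ideal p -> p `<=` @origin_ideal K m ->
  proj_irreducible (chart_closure p).
Proof.
move=> primep p0; split; first exact: chart_closure_closed.
  exists (e + chart_dir (fun=> 0)); apply: chart_closure_mem => f /p0.
  by [].
have sep Z : proj_closed Z -> ~ chart_closure p `<=` Z ->
    exists F, [/\ exists d, F \is d.-homog, ~ p (on_chart F) &
                  forall w, Z w -> F.@[bcoord b w] = 0].
  move=> [S [hS ZE]] nsub; apply: contrapT => nF; apply: nsub => w [w0 H].
  rewrite ZE; split=> // F SF; apply: H; first exact: hS.
  apply: contrapT => npF; apply: nF; exists F; split=> //; first exact: hS.
  by move=> u; rewrite ZE => -[_]; apply.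
move=> Z1 Z2 c1 c2 s12; apply: contrapT => /not_orP[/(sep _ c1)[F1 [[d1 h1] n1 v1]]].
move=> /(sep _ c2)[F2 [[d2 h2] n2 v2]].
have [t [nt pt]] := prime_zero primep (g := on_chart F1 * on_chart F2)
  (fun H => match primeM primep H with or_introl H1 => n1 H1 | or_intror H2 => n2 H2 end).
move: nt; rewrite mevalM !on_chart_eval mulf_eq0 negb_or => /andP[/eqP f1 /eqP f2].
by case: (s12 _ (chart_closure_mem pt)) => [/v1|/v2].
Qed.

(** An element of [q] outside [p] is nonzero at some zero of [p], and its homogenization keeps that
    point out of the closure for [q]. *)
Lemma chart_closure_proper p q : is_prime_ideal p -> p `<` q ->
  chart_closure q `<` chart_closure p.
Proof.
move=> primep [spq nqp]; split; first exact: chart_closureS.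
have [f [qf npf]] : exists f, q f /\ ~ p f.
  by apply: contrapT => nf; apply: nqp => f qf; apply: contrapT => pf; apply: nf; exists f.
have [t [/eqP ft pt]] := prime_zero primep npf.
have [F [d [hF Ff]]] := homogenize f.
move=> /(_ _ (chart_closure_mem pt))[_ /(_ F)]; rewrite -on_chart_eval Ff => H.
by apply: ft; apply: H => //; exists d.
Qed.

Lemma chart_closure_sub p : is_prime_ideal p -> chart_ideal r e h `<=` p ->
  chart_closure p `<=` rank_locus r E.
Proof.
move=> primep sJp w [w0 H]; have basisv := vbasisP {:W}.
have eE : e \in E by rewrite (basis_mem basisE) // mem_head.
have dirE t : e + chart_dir t \in E.
  rewrite rpredD // rpred_sum // => k _; rewrite rpredZ // (basis_mem basisE) //.
  by rewrite inE mem_tnth orbT.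
split; split=> //.
  apply/subspace_formP => i; rewrite -(lform_eval basisv); apply: H.
    by exists 1%N; apply: lform_homog.
  rewrite (_ : on_chart _ = 0); first exact: prime0 primep.
  apply: meval_eq0 => t; rewrite on_chart_eval lform_eval //.
  exact: (proj1 (subspace_formP E _) (dirE t)).
apply/rank_leP => phi psi; rewrite -(minor_poly_eval _ _ _ basisv); apply: H.
  by exists r.+1; apply: minor_poly_homog.
apply: sJp; exists 1%N, (fun=> 1), (fun=> chart_minor e h phi psi); split.
  by move=> _; exists phi, psi.
rewrite big_ord1 mul1r; apply/eqP; rewrite -subr_eq0; apply/eqP/meval_eq0 => t.
by rewrite mevalB on_chart_eval minor_poly_eval // chart_minor_eval subrr.
Qed.

(** Closure reverses inclusions, so the chain of primes is read backwards. *)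
Lemma chart_chain d :
  has_chain [set p | [/\ is_prime_ideal p, chart_ideal r e h `<=` p &
                         p `<=` @origin_ideal K m]] d ->
  chain_in (rank_locus r E) d.
Proof.
move=> [c [Hc ltc]]; exists (fun i => chart_closure (c (d - i)%N)); split=> i.
  move=> lei; have [|pr Jp p0] := Hc (d - i)%N; first exact: leq_subr.
  by split; [apply: chart_closure_irreducible | apply: chart_closure_sub].
move=> lti; apply: chart_closure_proper.
  by have [|pr _ _] := Hc (d - i.+1)%N; first exact: leq_subr.
have -> : (d - i = (d - i.+1).+1)%N by lia.
by apply: ltc; lia.
Qed.

End Chart.

(** * Lifts *)

Lemma has_chainW T (P : set (set T)) k l : (k <= l)%N -> has_chain P l -> has_chain P k.
Proof.
move=> lekl [c [Pc ltc]]; exists c; split=> i lti; first exact: Pc (leq_trans lti lekl).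
exact: ltc (leq_trans lti lekl).
Qed.

Section Chains.
Variables (K : numClosedFieldType) (W : vectType K).
Local Notation n := (\dim {:W}).
Implicit Types (X Z : set W).

Lemma chain_inS X Z k : X `<=` Z -> chain_in X k -> chain_in Z k.
Proof.
move=> sXZ [c [Hc ltc]]; exists c; split=> // i lei; have [irr sub] := Hc i lei.
by split=> //; apply: subset_trans sXZ.
Qed.

Lemma chain_in_top X k : chain_in X k -> exists Z,
  [/\ proj_irreducible Z, Z `<=` X & chain_in Z k].
Proof.
move=> [c [Hc ltc]]; exists (c k); have [irr sub] := Hc k (leqnn k); split=> //.
exists c; split=> // i lei; split; first by case: (Hc i lei).
move: lei => /subnKC; move: (k - i)%N => d; elim: d i => [|d IH] i; first by rewrite addn0 => ->.
rewrite addnS -addSn => E; have ltik : (i < k)%N by rewrite -E ltnS leq_addr.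
by apply: subset_trans (IH _ E); case: (ltc i ltik).
Qed.

Lemma chain_in_extend X Z Z' k : proj_irreducible Z' -> Z' `<=` X -> Z `<` Z' ->
  chain_in Z k -> chain_in X k.+1.
Proof.
move=> irr' sub' [sZ nZ] [c [Hc ltc]].
exists (fun i => if (i <= k)%N then c i else Z'); split=> i.
  move=> _; case: ifP => [/Hc[irr sub]|_] //; split=> //.
  by apply: subset_trans sub _; apply: subset_trans sub'.
rewrite ltnS => lei; rewrite lei; case: ltnP => [|ki]; first exact: ltc.
have [_ sub] := Hc i lei; split; first exact: subset_trans sZ.
by move=> s; apply: nZ; apply: subset_trans sub.
Qed.

(** Noether normalization by a linear projection, then the Jacobian bound. The dimension is that of
    the cone, one more than that of [Z]. *)
Lemma tangent_space_exists Z k w :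
    proj_irreducible Z -> chain_in Z k -> ~ chain_in Z k.+1 -> Z w ->
  exists (b : n.-tuple W) (T : {vspace W}),
    [/\ basis_of {:W} b, \dim T = k.+1 &
        forall M, M \in T -> forall f, vanishing b Z f ->
          dirderiv f (bcoord b w) (bcoord b M) = 0].
Proof.
move=> irrZ [c [Hc ltc]] nch Zw; have [cZ _ _] := irrZ.
have [L [dL ZL]] := avoid_subspace cZ nch.
have meet L' : (n <= \dim L' + k)%N -> exists2 u, Z u & u \in L'.
  move=> dL'; have [|u cu uL] := chain_meets _ ltc dL'.
    by move=> i /Hc[].
  by exists u => //; have [_] := Hc k (leqnn k); apply.
(* The choice of [L] bounds its codimension above; the chain in [Z], which meets every subspace of
   codimension at most [k], bounds it below. *)
have kE : (n - \dim L)%N = k.+1.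
  case: (leqP n (\dim L + k)) => [/meet[u /ZL]|]; first by move/negP.
  by lia.
have [b [basisb adaptb]] := adapted_basis L.
have surj : forall u, u \notin L -> exists2 l, l \in L & Z (u + l).
  by apply: meets_translate => // L' ltL; apply: meet; lia.
have indep : forall f, f \in tower K n k.+1 -> vanishing b Z f -> f = 0.
  by move=> f; rewrite -kE; apply: (projection_indep basisb adaptb) => //; rewrite kE.
have primeP := vanishing_prime basisb irrZ.
have lekn : (k.+1 <= n)%N by rewrite -kE leq_subr.
have [J [fJ JP]] := tangent_rank primeP lekn indep
  (fun f (Pf : vanishing b Z f) => Pf w Zw).
pose X := [tuple point b (J i) | i < k.+1].
have XE (z : 'I_k.+1 -> K) :
    \sum_(i < k.+1) z i *: X`_i = point b (((\row_i z i) *m J) 0).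
  rewrite /point; under [RHS]eq_bigr do rewrite mxE scaler_suml.
  rewrite exchange_big; apply: eq_bigr => i _.
  rewrite -[X`_i](tnth_nth 0 X i) tnth_mktuple /point scaler_sumr.
  by apply: eq_bigr => j _; rewrite mxE scalerA.
have freeX : free X.
  apply/freeP => z; rewrite XE => z0 i.
  have zJ : (\row_i z i) *m J = 0.
    apply/rowP => j; rewrite -(pointK basisb (((\row_i z i) *m J) 0) j) z0.
    by rewrite /bcoord linear0 mxE.
  have := row_free_inj fJ (etrans zJ (esym (mul0mx _ J))).
  by move=> /rowP/(_ i); rewrite !mxE.
exists b, <<X>>%VS; split=> // [|M /coord_span ME f Pf].
  by rewrite (eqnP freeX) size_tuple.
transitivity (((\row_i coord X i M) *m J *m (gradient f (bcoord b w))^T) 0 0).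
  rewrite [in LHS]ME XE [RHS]mxE; apply: eq_bigr => j _.
  by rewrite pointK // mulrC; congr (_ * _); rewrite !mxE.
by rewrite -mulmxA JP // mulmx0 mxE.
Qed.

End Chains.

Section Lifts.
Variables (K : numClosedFieldType) (U C : vectType K).
Local Notation W := 'Hom(U, C).
Local Notation n := (\dim {:W}).
Implicit Types (v : W) (E : {vspace W}) (r : nat).

Lemma dim_add_vline E v : v \notin E -> \dim (E + <[v]>)%VS = (\dim E).+1.
Proof.
move=> vE; rewrite dimv_disjoint_sum ?dim_vline.
  by rewrite (_ : v != 0) ?addn1 //; apply: contraNneq vE => ->; apply: mem0v.
apply/eqP; rewrite -subv0; apply/subvP => u; rewrite memv_cap memv0 => /andP[uE].
case/vlineP => a ua; move: uE; rewrite ua rpredZeq (negbTE vE) orbF => /eqP->.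
by rewrite scale0r.
Qed.

(** Keeps the truncated predecessor in [proj_codim] an honest dimension. *)
Lemma rank_locus_dim_gt0 r E : rank_locus r E !=set0 -> (0 < \dim E)%N.
Proof.
move=> [e [[e0 eE] _]]; rewrite lt0n dimv_eq0.
by apply: contraNneq e0 => E0; rewrite -memv0 -E0.
Qed.

Lemma proj_dim_section r E E' D D' : (E <= E')%VS ->
    proj_dim (rank_locus r E) D -> has_chain
      [set Z | proj_irreducible Z /\ Z `<=` rank_locus r E'] D' ->
  (D' <= D + (\dim E' - \dim E))%N.
Proof.
move=> sEE' [_ maxD] chain; have [M [dM locE]] := rank_locus_section r sEE'.
rewrite leqNgt; apply/negP => ltD.
have ch : chain_in (rank_locus r E') (D.+1 + (\dim E' - \dim E)).
  by apply: has_chainW chain; lia.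
have := chain_in_section (rank_locus_closed r E') ch (M := M).
rewrite dM -locE => /(_ (leqnn _))/maxD; rewrite ltnn; exact.
Qed.

(** The section bound from [E] to [E1] limits the dimension above by [D.+1], the one from [E1] to
    [E'] below by [D.+1]. *)
Lemma lift_step r E E' v : rank_locus r E !=set0 -> is_lift r E E' ->
  v \in E' -> v \notin E -> is_lift r E (E + <[v]>)%VS.
Proof.
move=> /rank_locus_dim_gt0 dE [sEE' _ [c [[D [dimD cD]] [D' [dimD' cD']]]]] vE' vE.
set E1 := (E + <[v]>)%VS.
have sE1 : (E <= E1)%VS by apply: addvSl.
have sE1' : (E1 <= E')%VS by rewrite subv_add sEE' -memvE.
have dE1 : \dim E1 = (\dim E).+1 by apply: dim_add_vline.
have dE' := dimvS sE1'.
have {}cD : (D + c)%N = (\dim E).-1 := cD.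
have {}cD' : (D' + c)%N = (\dim E').-1 := cD'.
split=> //; first by apply: contraNneq vE => ->; rewrite (subvP (addvSr E _)) ?memv_line.
exists c; split; first by exists D.
exists D.+1; split; last by rewrite dE1 addSn cD prednK.
split; last first.
  by move=> k ch; have := proj_dim_section sE1 dimD ch; rewrite dE1; lia.
have [M [dM locE1]] := rank_locus_section r sE1'.
have [chD' _] := dimD'; rewrite locE1.
apply: (chain_in_section (rank_locus_closed r E') (q := \dim E' - \dim E1)).
  by apply: has_chainW chD'; lia.
by rewrite dM.
Qed.

Lemma RND_lift r E v : rank_locus r E !=set0 -> is_lift r E (E + <[v]>)%VS -> RND r E v.
Proof.
move=> /rank_locus_dim_gt0 dE [sEE' nEE' [c [[D [dimD cD]] [D' [dimD' cD']]]]].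
set E' := (E + <[v]>)%VS in sEE' nEE' dimD' cD'.
have vE : v \notin E.
  apply: contraNN nEE' => vE; rewrite eqEsubv sEE' /=.
  by rewrite subv_add subvv -memvE.
have dE' : \dim E' = (\dim E).+1 by apply: dim_add_vline.
have D'E : D' = D.+1 by apply: (@addIn c); rewrite cD' dE' addSn cD prednK.
have [chD maxD] := dimD; have [chD' maxD'] := dimD'; rewrite D'E in chD' maxD'.
have [Z' [irrZ' sZ' chZ']] := chain_in_top chD'.
have [M [dM locE]] := rank_locus_section r sEE'.
(* Cutting [Z'] itself, and not the whole locus, places every point of [Z] on [Z'], whose tangent
   spaces are large. *)
have [Z [irrZ sZ chZ]] : exists Z, [/\ proj_irreducible Z,
    Z `<=` Z' `&` [set w | w != 0 /\ w \in M] & chain_in Z D].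
  apply: chain_in_top; apply: (chain_in_section (q := 1)); rewrite ?addn1 //.
    by case: irrZ'.
  by rewrite -dM dE' subSnn addn1.
have sZY : Z `<=` rank_locus r E.
  by rewrite locE => w /sZ[/sZ' Yw]; split.
exists Z.
  split.
    split=> // Z'' irr'' sZ'' sub''; apply: contrapT => neq.
    have lt : Z `<` Z''.
      by split=> // s; apply: neq; apply/seteqP.
    by have := maxD _ (chain_in_extend irr'' sub'' lt chZ); rewrite ltnn.
  exists D; split=> //; split=> // k chk.
  by apply: maxD; apply: chain_inS chk.
move=> e [Ze [h [basisE [d [dimd cotd]]]] re].
apply: contrapT => nv.
have Z'e : Z' e by case: (sZ e Ze).
have nch : ~ chain_in Z' D.+2.
  by move=> /(chain_inS sZ')/maxD'; rewrite ltnn.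
have [b [T [basisb dT tanT]]] := tangent_space_exists irrZ' chZ' nch Z'e.
have TP u : u \in T -> u \in E /\ neutral e u.
  move=> uT; have [uE' nu] := tangent_neutral basisb sZ' Z'e re (tanT u uT).
  split=> //; move/memv_addP: uE' => [x xE [y /vlineP[a ->] uE]].
  have [a0|a0] := eqVneq a 0; first by rewrite uE a0 scale0r addr0.
  (* A neutral vector of [E'] outside [E] has a nonzero component along [v], and solving for [v]
     places it in [E] plus the neutral space. *)
  case: nv; exists (- (a^-1 *: x)); first by rewrite /= rpredN rpredZ.
  exists (a^-1 *: u).
    apply/subvP => _ /memv_imgP[k ke ->]; rewrite scale_lfunE rpredZ //.
    by apply: (subvP nu); apply: memv_img.
  by rewrite uE scalerDr scalerA mulVf // scale1r addKr.
have ler : (rank e <= r)%N by rewrite re.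
have : (\dim T <= d.+1)%N.
  by apply: (cotangent_bound basisE ler cotd) => [|u /TP[]//]; apply/subvP => u /TP[].
(* The contradiction is between [D.+2 <= d.+1] and [d <= D]. *)
have := maxD _ (chart_chain basisE ler (proj1 dimd)).
by rewrite dT ltnS => /leq_ltn_trans lt /lt; rewrite ltnn.
Qed.

End Lifts.

Theorem theorem4 (R : realType) (B C : vectType R[i]) (r : nat)
    (E : {vspace 'Hom('Hom(B, (R[i])^o), C)}) :
  \dim {:B} = \dim {:C} ->
  (1 <= r)%N ->
  rank_locus r E !=set0 ->
  (forall v : 'Hom('Hom(B, (R[i])^o), C),
     is_lift r E (E + <[v]>)%VS -> RND r E v) /\
  ([set` E] = RND r E -> unliftable r E).
Proof.
move=> _ _ Y0; split=> [v|ERND [E' liftE']]; first exact: RND_lift.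
have [sEE' nEE' _] := liftE'.
have /subvPn[v vE' vE] : ~~ (E' <= E)%VS.
  by apply: contraNN nEE' => sE'E; rewrite eqEsubv sEE'.
have := RND_lift Y0 (lift_step Y0 liftE' vE' vE).
by rewrite -ERND /= (negbTE vE).
Qed.
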